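(* Let $n\ge2$ and let $u=(u_1,\ldots,u_n):\mathbb{B}^n\to\mathbb{R}^n$ be a vector-valued function whose image $u(\mathbb{B}^n)$ is a proper subdomain of $\mathbb{R}^n$, such that for each $k\in\{1,\ldots,n\}$, $u_k\in\mathcal{C}^2(\mathbb{B}^n)$ and $\Delta u_k=\lambda_k u_k$ in $\mathbb{B}^n$, where $\lambda_k$ is a nonnegative constant. Then the following conditions are equivalent. (1) $u$ is weakly uniformly bounded in $\mathbb{B}^n$; (2) there exists a constant $C$ such that, for all $x,y\in\mathbb{B}^n$, $$k_{u(\mathbb{B}^n)}(u(x),u(y))\le C\,k_{\mathbb{B}^n}(x,y).$$
   Context: $\mathbb{B}^n$ is the open unit ball of $\mathbb{R}^n$. A domain is a nonempty open connected set. For a proper subdomain $\Omega$ of $\mathbb{R}^n$, $d_\Omega(x)$ denotes the Euclidean distance from $x\in\Omega$ to $\partial\Omega$, and for $x,y\in\Omega$, $$r_\Omega(x,y)=\frac{|x-y|}{\min\{d_\Omega(x),d_\Omega(y)\}}.$$ A map $f:\Omega\to f(\Omega)\subset\mathbb{R}^n$ (with $f(\Omega)$ a proper subdomain) is weakly uniformly bounded in $\Omega$ if there is a constant $C>0$ such that $r_\Omega(x,y)\le 1/2$ implies $r_{f(\Omega)}(f(x),f(y))\le C$. The quasihyperbolic distance on $\Omega$ is $$k_\Omega(x,y)=\inf_\gamma\int_\gamma\frac{ds(z)}{d_\Omega(z)},$$ where the infimum is over all rectifiable arcs $\gamma\subset\Omega$ joining $x$ and $y$ and $ds$ is arc length.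 *)

(* Defs.v *)
From HB Require Import structures.
From mathcomp Require Import all_boot all_order all_algebra.
From mathcomp Require Import all_classical all_reals all_analysis.

Set Implicit Arguments.
Unset Strict Implicit.
Unset Printing Implicit Defensive.

Import Order.TTheory GRing.Theory Num.Theory.
Import numFieldNormedType.Exports.

Local Open Scope classical_set_scope.
Local Open Scope ring_scope.

(* R^n is 'rV[R]_n. The library norm on 'rV[R]_n is the
   sup-norm: it induces the usual topology, so open, connected, closure,
   continuity and differentiability are the library notions, but every
   distance below is computed with the Euclidean norm enorm. *)

Definition enorm (R : realType) (n : nat) (x : 'rV[R]_n) : R :=
  Num.sqrt (\sum_(i < n) x ord0 i ^+ 2).

Definition unit_ball (R : realType) (n : nat) : set 'rV[R]_n :=
  [set x | enorm x < 1].

Definition is_domain (R : realType) (n : nat) (D : set 'rV[R]_n) : Prop :=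
  [/\ D !=set0, open D & connected D].

Definition proper_subdomain (R : realType) (n : nat) (D : set 'rV[R]_n) : Prop :=
  is_domain D /\ D <> setT.

Definition boundary (T : topologicalType) (A : set T) : set T :=
  closure A `\` interior A.

(* For a proper subdomain D the boundary is nonempty, so this infimum is over
   a nonempty set of nonnegative reals. *)
Definition bdist (R : realType) (n : nat) (D : set 'rV[R]_n) (x : 'rV[R]_n) : R :=
  inf [set enorm (x - z) | z in boundary D].

Definition rdist (R : realType) (n : nat) (D : set 'rV[R]_n)
    (x y : 'rV[R]_n) : R :=
  enorm (x - y) / Num.min (bdist D x) (bdist D y).

Definition weakly_uniformly_bounded (R : realType) (n : nat)
    (D : set 'rV[R]_n) (f : 'rV[R]_n -> 'rV[R]_n) : Prop :=
  exists2 C : R, 0 < C &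
    forall x y, D x -> D y -> rdist D x y <= 1 / 2 ->
      rdist (f @` D) (f x) (f y) <= C.

(* Length of g on [a, b], for a <= b: supremum over the subdivisions
   a = t_0 < t_1 < ... < t_m = b, encoded by s = [:: t_1; ...; t_m]. *)
Definition curve_length (R : realType) (n : nat) (g : R -> 'rV[R]_n)
    (a b : R) : \bar R :=
  ereal_sup [set (\sum_(0 <= i < size s)
                    enorm (g (nth b (a :: s) i.+1) - g (nth b (a :: s) i)))%:E
            | s in itv_partition a b].

(* An arc is a homeomorphic image of a compact interval. The case a = b gives
   the arc reduced to one point, the only one joining a point to itself. *)
Definition rectifiable_arc (R : realType) (n : nat) (D : set 'rV[R]_n)
    (x y : 'rV[R]_n) (a b : R) (g : R -> 'rV[R]_n) : Prop :=
  [/\ a <= b,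
      {within `[a, b], continuous g} /\ {in `[a, b] &, injective g},
      forall t, t \in `[a, b] -> D (g t),
      g a = x /\ g b = y
    & (curve_length g a b < +oo)%E].

(* Arc length representation of g on [0, L], L being the length of g:
   its value at s is g t for the first t in [a, b] at which the length of g
   on [a, t] reaches s. *)
Definition arclength_param (R : realType) (n : nat) (g : R -> 'rV[R]_n)
    (a b : R) (s : R) : 'rV[R]_n :=
  g (inf [set t | t \in `[a, b] /\ (s%:E <= curve_length g a t)%E]).

Definition arc_integral (R : realType) (n : nat) (g : R -> 'rV[R]_n)
    (a b : R) (rho : 'rV[R]_n -> R) : \bar R :=
  (\int[lebesgue_measure]_(s in `[0%R, fine (curve_length g a b)])
      (rho (arclength_param g a b s))%:E)%E.

Definition qh_dist (R : realType) (n : nat) (D : set 'rV[R]_n)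
    (x y : 'rV[R]_n) : \bar R :=
  ereal_inf [set v | exists a b g, rectifiable_arc D x y a b g /\
                       v = arc_integral g a b (fun z => (bdist D z)^-1)].

Definition coord_fun (R : realType) (n : nat) (u : 'rV[R]_n -> 'rV[R]_n)
    (k : 'I_n) : 'rV[R]_n -> R := fun x => u x ord0 k.

Definition basis_vec (R : realType) (n : nat) (i : 'I_n) : 'rV[R]_n :=
  delta_mx ord0 i.

Definition partial (R : realType) (n : nat) (i : 'I_n) (f : 'rV[R]_n -> R) :
    'rV[R]_n -> R := fun x => 'D_(basis_vec R i) f x.

(* Meant for D open: the values of f outside D are then irrelevant. *)
Definition C2_on (R : realType) (n : nat) (D : set 'rV[R]_n)
    (f : 'rV[R]_n -> R) : Prop :=
  forall x, D x ->
  [/\ {for x, continuous f},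
      forall i, derivable f x (basis_vec R i) /\
                {for x, continuous (partial i f)}
    & forall i j, derivable (partial i f) x (basis_vec R j) /\
                  {for x, continuous (partial j (partial i f))}].

Definition laplacian (R : realType) (n : nat) (f : 'rV[R]_n -> R)
    (x : 'rV[R]_n) : R := \sum_(i < n) partial i (partial i f) x.

(* Main.v *)
(* (2) => (1): along an arc, d(x) + |x - p| grows at most like exp of twice the
   quasihyperbolic length, so k(u x, u y) <= K bounds |u x - u y| by
   exp(2K) d(u x); and k_B <= 1 on pairs with r_B <= 1/2.

   (1) => (2): weak uniform boundedness says that u oscillates by at most
   C d(u x) on a ball of radius comparable to d_B(x). An interior estimate for
   the equation Delta f = lambda f, obtained from the maximum principle by
   comparing the odd part of f in a coordinate direction with a quadratic
   supersolution, turns this into |u x - u y| <= K d(u x) |x - y| / d_B(x) for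
   x, y close. Following an arc of the ball in small steps, the images of
   consecutive points are joined by segments; the resulting path is kept
   injective and parametrized by arc length by cutting it, each time a segment
   is added, at its first meeting point with that segment. *)

Require Import Defs.
From HB Require Import structures.
From mathcomp Require Import all_boot all_order all_algebra.
From mathcomp Require Import all_classical all_reals all_analysis.
From mathcomp Require Import measurable_realfun ring lra.

Set Implicit Arguments.
Unset Strict Implicit.
Unset Printing Implicit Defensive.

Import Order.TTheory GRing.Theory Num.Theory.
Import numFieldNormedType.Exports.

Local Open Scope classical_set_scope.
Local Open Scope ring_scope.

(** Weak uniform boundedness controls the oscillation of u near x on the scale d(u x) and says
    nothing about the size of u, whereas the source term of the equation is lambda u. The link is
    that an oscillation M of f on a cube of half-side r <= 1 already bounds lambda |f| there by a
    multiple of M / r^2: a value much larger than M forces a constant sign, and a large Laplacian of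
    constant sign would make f vary by more than M.

    The image of an arc under u is not an admissible competitor for k, because u need not be
    injective. A competitor in the image is therefore built one segment at a time, and the invariant
    carried along ([qh_joined]) contains injectivity and unit speed together with the bound on the
    cost.

    Both implications propagate a relation between a point of an arc and the cost accumulated so
    far; [arc_chain] isolates this induction. The recurring factor 2 comes from d being 1-Lipschitz:
    within distance d(p) of p, the distance to the boundary is at most 2 d(p). *)

Local Notation qh_integral D g a b :=
  (arc_integral g a b (fun z => (bdist D z)^-1)).

(** * The Euclidean norm and its comparison with the sup-norm topology *)

Section EuclideanNorm.
Context {R : realType} {n : nat}.
Implicit Types x y z : 'rV[R]_n.

Lemma sumsqr_ge0 x : 0 <= \sum_(i < n) x ord0 i ^+ 2.
Proof. by apply: sumr_ge0 => i _; exact: sqr_ge0. Qed.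

Lemma enorm_ge0 x : 0 <= enorm x.
Proof. exact: sqrtr_ge0. Qed.

Lemma sqr_enorm x : enorm x ^+ 2 = \sum_(i < n) x ord0 i ^+ 2.
Proof. by rewrite sqr_sqrtr ?sumsqr_ge0. Qed.

Lemma enorm0 : enorm (0 : 'rV[R]_n) = 0.
Proof.
by rewrite /enorm big1 ?sqrtr0// => i _; rewrite mxE expr0n.
Qed.

Lemma enormN x : enorm (- x) = enorm x.
Proof. by congr Num.sqrt; apply: eq_bigr => i _; rewrite mxE sqrrN. Qed.

Lemma enormB x y : enorm (x - y) = enorm (y - x).
Proof. by rewrite -enormN opprB. Qed.

Lemma enormZ (a : R) x : enorm (a *: x) = `|a| * enorm x.
Proof.
rewrite /enorm -sqrtr_sqr -sqrtrM ?sqr_ge0//; congr Num.sqrt.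
by rewrite mulr_sumr; apply: eq_bigr => i _; rewrite mxE exprMn.
Qed.

Lemma coord_le_enorm x i : `|x ord0 i| <= enorm x.
Proof.
rewrite -sqrtr_sqr ler_wsqrtr// (bigD1 i)//= lerDl.
by apply: sumr_ge0 => j _; exact: sqr_ge0.
Qed.

Lemma enorm_eq0 x : enorm x = 0 -> x = 0.
Proof.
move=> x0; apply/rowP => i; rewrite mxE; apply/eqP.
by rewrite -normr_le0 -x0 coord_le_enorm.
Qed.

Lemma cauchy_schwarz x y :
  \sum_(i < n) x ord0 i * y ord0 i <= enorm x * enorm y.
Proof.
set A := enorm x; set B := enorm y.
have [A0|A0] := eqVneq A 0.
  rewrite A0 mul0r big1// => i _.
  by rewrite (enorm_eq0 A0) mxE mul0r.
have [B0|B0] := eqVneq B 0.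
  rewrite B0 mulr0 big1// => i _.
  by rewrite (enorm_eq0 B0) mxE mulr0.
have AB : 0 < A * B by rewrite mulr_gt0// lt_def ?A0 ?B0 enorm_ge0.
have EA : A ^+ 2 = _ := sqr_enorm x; have EB : B ^+ 2 = _ := sqr_enorm y.
clearbody A B; set S := \sum_(i < n) _.
(* Expanding this nonnegative sum gives 2AB(AB - S), and AB > 0 can be divided out. *)
have : 0 <= \sum_(i < n) (x ord0 i * B - y ord0 i * A) ^+ 2.
  by apply: sumr_ge0 => i _; exact: sqr_ge0.
have -> : \sum_(i < n) (x ord0 i * B - y ord0 i * A) ^+ 2 =
    (A * B) * (A * B - S) *+ 2.
  transitivity (A ^+ 2 * B ^+ 2 + B ^+ 2 * A ^+ 2 - (A * B) * S *+ 2);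
    last by ring.
  rewrite {1}EA {2}EB /S mulr_suml mulr_suml mulr_sumr -sumrMnl.
  rewrite -sumrN -!big_split/=; apply: eq_bigr => i _; ring.
by rewrite pmulrn_lge0// pmulr_rge0// subr_ge0.
Qed.

Lemma enormD x y : enorm (x + y) <= enorm x + enorm y.
Proof.
rewrite -(ler_pXn2r (_ : 0 < 2)%N) ?nnegrE ?addr_ge0 ?enorm_ge0//.
rewrite sqrrD !sqr_enorm.
have -> : \sum_(i < n) (x + y) ord0 i ^+ 2 = \sum_(i < n) x ord0 i ^+ 2
   + (\sum_(i < n) x ord0 i * y ord0 i) *+ 2 + \sum_(i < n) y ord0 i ^+ 2.
  rewrite -sumrMnl -!big_split/=; apply: eq_bigr => i _.
  by rewrite mxE; ring.
by rewrite lerD2r lerD2l lerMn2r/= cauchy_schwarz.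
Qed.

Lemma enorm_distD z x y : enorm (x - y) <= enorm (x - z) + enorm (z - y).
Proof. by rewrite (le_trans _ (enormD _ _))// addrA subrK. Qed.

Lemma enorm_lipschitz x y : `|enorm x - enorm y| <= enorm (x - y).
Proof.
rewrite ler_norml; apply/andP; split.
  by rewrite lerNl opprB lerBlDr enormB (le_trans _ (enormD _ _))// subrK.
by rewrite lerBlDr (le_trans _ (enormD _ _))// subrK.
Qed.

Lemma enorm_le_sum x : enorm x <= \sum_(i < n) `|x ord0 i|.
Proof.
have S0 : 0 <= \sum_(i < n) `|x ord0 i| by apply: sumr_ge0.
rewrite -(ler_pXn2r (_ : 0 < 2)%N) ?nnegrE ?enorm_ge0//.
rewrite sqr_enorm expr2 mulr_suml; apply: ler_sum => i _.
rewrite -real_normK ?num_real// expr2.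
by rewrite ler_wpM2l// (bigD1 i)//= lerDl; apply: sumr_ge0.
Qed.

Lemma enorm_le_coord x (d : R) : (forall i, `|x ord0 i| <= d) ->
  enorm x <= n%:R * d.
Proof.
move=> xd; rewrite (le_trans (enorm_le_sum x))//.
rewrite (le_trans (ler_sum _ (fun i _ => xd i)))//.
by rewrite big_const_ord iter_addr_0 mulr_natl.
Qed.

Lemma coord_le_norm x i : `|x ord0 i| <= `|x|.
Proof.
have := mx_normrE x; rewrite -[mx_norm x]/(`|x|) => ->.
exact: (le_bigmax _ (fun ij => `|x ij.1 ij.2|) (ord0, i)).
Qed.

Lemma norm_le_enorm x : `|x| <= enorm x.
Proof.
have := mx_normrE x; rewrite -[mx_norm x]/(`|x|) => ->.
apply: bigmax_le => [|[i j] _]; first exact: enorm_ge0.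
by rewrite /= ord1 coord_le_enorm.
Qed.

Lemma enorm_le_norm x : enorm x <= n%:R * `|x|.
Proof. by apply: enorm_le_coord => i; exact: coord_le_norm. Qed.

Lemma open_eball (D : set 'rV[R]_n) x : open D -> D x ->
  exists2 e : R, 0 < e & forall y, enorm (x - y) < e -> D y.
Proof.
move=> oD Dx; have /nbhs_ballP[e /= e0 eD] : nbhs x D by exact: open_nbhs_nbhs.
exists e => // y xy; apply: eD; rewrite -ball_normE/=.
exact: le_lt_trans (norm_le_enorm _) xy.
Qed.

Lemma cvg_enormP (T : Type) (F : set_system T) {FF : Filter F}
    (f : T -> 'rV[R]_n) (l : 'rV[R]_n) :
  f @ F --> l <-> forall e, 0 < e -> \forall t \near F, enorm (f t - l) < e.
Proof.
split => [/cvgrPdist_lt fl e e0|fl].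
  have en : 0 < e / (n%:R + 1) by rewrite divr_gt0// ltr_wpDl.
  near=> t; rewrite enormB (le_lt_trans (enorm_le_norm _))//.
  have : `|l - f t| < e / (n%:R + 1) by near: t; exact: fl.
  rewrite ltr_pdivlMr ?ltr_wpDl// => h; rewrite (le_lt_trans _ h)//.
  by rewrite mulrC ler_wpM2l// lerDl.
apply/cvgrPdist_lt => e e0; near=> t.
rewrite (le_lt_trans (norm_le_enorm _))// enormB.
by near: t; exact: fl.
Unshelve. all: by end_near. Qed.

Lemma near_enorm x (e : R) : 0 < e -> \forall y \near x, enorm (y - x) < e.
Proof.
have : id @ x --> x by exact: cvg_id.
by move/(@cvg_enormP _ _ (nbhs_filter x) id x); exact.
Qed.

Lemma lipschitz_enorm_continuous (f : R -> 'rV[R]_n) (k : R) :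
  (forall s t, enorm (f s - f t) <= k * `|s - t|) -> continuous f.
Proof.
move=> fk t; apply/cvg_enormP => e e0.
have k1 : 0 < `|k| + 1 by rewrite ltr_wpDl.
have : \forall s \near t, `|t - s| < e / (`|k| + 1).
  have /cvgrPdist_lt : id @ t --> t by exact: cvg_id.
  by apply; rewrite divr_gt0.
apply: filterS => s; rewrite ltr_pdivlMr// => st.
rewrite (le_lt_trans (fk s t))// (le_lt_trans _ st)// mulrC distrC ler_wpM2l//.
by rewrite (le_trans (ler_norm _))// lerDl.
Qed.

End EuclideanNorm.

(** * Distance to the boundary of a domain *)

Section BoundaryDistance.
Context {R : realType} {n : nat}.
Implicit Types (D : set 'rV[R]_n) (x y z : 'rV[R]_n).

Lemma boundary_dist_le D x z : boundary D z -> bdist D x <= enorm (x - z).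
Proof.
move=> bz; apply: ge_inf; last by exists z.
by exists 0 => _ [w _ <-]; exact: enorm_ge0.
Qed.

(** The boundary point is the first exit from D on the segment from x to y. Openness puts the exit
    point [g r] outside D, and the points just before it are in D, so it lies in the closure. This
    yields both that the ball of radius [bdist D x] about x stays in D and that a proper subdomain
    has a boundary point. *)
Lemma boundary_segment D x y : open D -> D x -> ~ D y ->
  exists2 z, boundary D z & enorm (x - z) <= enorm (x - y).
Proof.
move=> oD Dx nDy; pose g (t : R) := x + t *: (y - x).
have gE s t : g s - g t = (s - t) *: (y - x).
  by rewrite /g scalerBl opprD addrACA subrr add0r.
pose E := [set t : R | 0 <= t <= 1 /\ ~ D (g t)].
have E1 : E 1 by split; [lra|rewrite /g scale1r addrC subrK].
have hE : has_inf E.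
  by split; [exists 1 | exists 0 => t [/andP[]]].
pose r := inf E.
have r0 : 0 <= r by apply: lb_le_inf; [exists 1|move=> t [/andP[]]].
have r1 : r <= 1 by apply: ge_inf => //; exact: hE.2.
have Dlt t : 0 <= t -> t < r -> D (g t).
  move=> t0 tr; apply: contrapT => nD.
  have : r <= t.
    apply: ge_inf; first exact: hE.2.
    by split => //; rewrite t0 (le_trans (ltW tr)).
  by rewrite leNgt tr.
have [d0|d0] := eqVneq (enorm (y - x)) 0.
  by move: nDy; rewrite -(subrK x y) (enorm_eq0 d0) add0r.
have {}d0 : 0 < enorm (y - x) by rewrite lt_def d0 enorm_ge0.
have nDr : ~ D (g r).
  move=> Dr; have [e e0 eD] := open_eball oD Dr.
  have ed : 0 < e / enorm (y - x) by rewrite divr_gt0.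
  have [t [t01 nDt] tr] := inf_adherent ed hE.
  have rt : r <= t by apply: (ge_inf hE.2); exact: conj t01 nDt.
  apply: nDt; apply: eD; rewrite gE enormZ -ltr_pdivlMr//.
  by rewrite distrC ger0_norm ?subr_ge0// ltrBlDl.
exists (g r); last first.
  rewrite /g opprD addrA subrr add0r enormN enormZ (enormB x y) ger0_norm//.
  by rewrite ler_piMl// enorm_ge0.
split; last by move=> /interior_subset.
have r_gt0 : 0 < r.
  rewrite lt_def r0 andbT; apply: contra_notN nDr => /eqP ->.
  by rewrite /g scale0r addr0.
move=> V /nbhs_ballP[e /= e0 eV].
have ed : 0 < e / enorm (y - x) by rewrite divr_gt0.
pose t := Num.max 0 (r - e / enorm (y - x) / 2).
have t0 : 0 <= t by rewrite le_max lexx.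
have tr : t < r by rewrite gt_max r_gt0/=; lra.
exists (g t); split; first exact: Dlt.
apply: eV; rewrite -ball_normE/= (le_lt_trans (norm_le_enorm _))//.
rewrite gE enormZ -ltr_pdivlMr// gtr0_norm ?subr_gt0//.
have : r - e / enorm (y - x) / 2 <= t by rewrite le_max lexx orbT.
lra.
Qed.

Lemma bdist_le_outside D x y : open D -> D x -> ~ D y ->
  bdist D x <= enorm (x - y).
Proof.
move=> oD Dx nDy; have [z bz] := boundary_segment oD Dx nDy.
exact/le_trans/boundary_dist_le.
Qed.

Lemma lt_bdist D x y : open D -> D x -> enorm (x - y) < bdist D x -> D y.
Proof.
move=> oD Dx xy; apply: contrapT => nDy.
by move: xy; rewrite ltNge bdist_le_outside.
Qed.

Lemma boundary_neq0 D : proper_subdomain D -> boundary D !=set0.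
Proof.
move=> [[[x Dx] oD _] DT]; have [y nDy] : exists y, ~ D y.
  by apply/not_existsP => DA; apply: DT; rewrite -subTset => y _; exact: contrapT.
by have [z bz _] := boundary_segment oD Dx nDy; exists z.
Qed.

Lemma bdist_lipschitz D x y : proper_subdomain D ->
  bdist D x <= bdist D y + enorm (x - y).
Proof.
move=> /boundary_neq0[w bw]; rewrite -lerBlDr; apply: lb_le_inf.
  by exists (enorm (y - w)); exists w.
move=> _ [z bz <-]; rewrite lerBlDr (le_trans (boundary_dist_le x bz))//.
by rewrite [leRHS]addrC enorm_distD.
Qed.

Lemma bdist_gt0 D x : proper_subdomain D -> D x -> 0 < bdist D x.
Proof.
move=> pD Dx; have [[_ oD _] _] := pD.
have [e e0 eD] := open_eball oD Dx.
have [w bw] := boundary_neq0 pD.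
apply: (lt_le_trans e0); apply: lb_le_inf; first by exists (enorm (x - w)); exists w.
move=> _ [z [_ nz] <-]; rewrite leNgt; apply/negP => /eD Dz; apply: nz.
by rewrite (interior_id D).1.
Qed.

Lemma bdist_ge0 D x : proper_subdomain D -> 0 <= bdist D x.
Proof.
move=> /boundary_neq0[w bw]; apply: lb_le_inf; first by exists (enorm (x - w)); exists w.
by move=> _ [z _ <-]; exact: enorm_ge0.
Qed.

Lemma bdist_continuous D : proper_subdomain D ->
  continuous (bdist D : 'rV[R]_n -> R).
Proof.
move=> pD x; apply/(@cvgrPdist_lt _ _ _ (nbhs x)) => e e0.
near=> y; have xy : enorm (y - x) < e by near: y; exact: near_enorm.
apply: le_lt_trans xy.
have := bdist_lipschitz x y pD; have := bdist_lipschitz y x pD.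
by rewrite (enormB x y) => h1 h2; rewrite ler_norml; apply/andP; split; lra.
Unshelve. all: by end_near. Qed.

End BoundaryDistance.

(** * Length and integrals along arcs *)

Section CurveLength.
Context {R : realType} {n : nat}.
Implicit Types (g : R -> 'rV[R]_n) (a b s t : R) (p : seq R).

(** The sum occurring in [curve_length]. The default [b] of [nth] is never read, as the indices stay
    within [a :: p]; this is why [polygon_length_rcons] may change it. *)
Definition polygon_length g b a p : R :=
  \sum_(0 <= i < size p)
    enorm (g (nth b (a :: p) i.+1) - g (nth b (a :: p) i)).

Lemma polygon_length_nil g b a : polygon_length g b a [::] = 0.
Proof. by rewrite /polygon_length big_geq. Qed.

Lemma polygon_length_cons g b a t p :
  polygon_length g b a (t :: p) = enorm (g t - g a) + polygon_length g b t p.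
Proof. by rewrite /polygon_length /= big_nat_recl. Qed.

Lemma polygon_length_rcons g b c a t p : polygon_length g b a (rcons p t) =
  polygon_length g c a p + enorm (g t - g (last a p)).
Proof.
elim: p a => [|r p ih] a /=.
  by rewrite polygon_length_cons !polygon_length_nil addr0 add0r.
by rewrite !polygon_length_cons ih addrA.
Qed.

Lemma polygon_length_ge0 g b a p : 0 <= polygon_length g b a p.
Proof. by apply: sumr_ge0 => i _; exact: enorm_ge0. Qed.

Lemma eq_polygon_length g g' b a p : itv_partition a b p ->
  (forall t, a <= t <= b -> g t = g' t) ->
  polygon_length g b a p = polygon_length g' b a p.
Proof.
elim: p a => [|r p ih] a; first by rewrite !polygon_length_nil.
move=> abp gg'; have ab := itv_partition_le abp.
have rbp := itv_partition_cons abp; have rb := itv_partition_le rbp.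
have ar : a <= r by case: abp => /andP[/ltW].
rewrite !polygon_length_cons !gg' ?lexx ?ab ?ar ?rb//; congr (_ + _).
by apply: ih => // t /andP[rt tb]; apply: gg'; rewrite (le_trans ar rt).
Qed.

Lemma polygon_length_lipschitz g b a p : itv_partition a b p ->
  (forall s t, a <= s -> s <= t -> t <= b -> enorm (g t - g s) <= t - s) ->
  polygon_length g b a p <= b - a.
Proof.
elim: p a => [|r p ih] a abp gl.
  by rewrite polygon_length_nil subr_ge0 (itv_partition_le abp).
have rbp := itv_partition_cons abp; have rb := itv_partition_le rbp.
have ar : a <= r by case: abp => /andP[/ltW].
rewrite polygon_length_cons.
have h1 := gl a r (lexx a) ar rb.
have : polygon_length g b r p <= b - r.
  by apply: ih => // s t rs; apply: gl; exact: le_trans rs.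
lra.
Qed.

Lemma curve_length_ub g a b p : itv_partition a b p ->
  ((polygon_length g b a p)%:E <= curve_length g a b)%E.
Proof. by move=> abp; apply: ereal_sup_ubound; exists p. Qed.

Lemma curve_length_le g a b (l : \bar R) :
  (forall p, itv_partition a b p -> ((polygon_length g b a p)%:E <= l)%E) ->
  (curve_length g a b <= l)%E.
Proof. by move=> h; apply: ge_ereal_sup => _ [p abp <-]; exact: h. Qed.

Lemma curve_length_ge0 g a b : a <= b -> (0 <= curve_length g a b)%E.
Proof.
rewrite le_eqVlt => /predU1P[<-|ab].
  have /(curve_length_ub g) : itv_partition a a [::] by split => /=.
  by rewrite polygon_length_nil.
apply: le_trans (curve_length_ub g (itv_partition1 ab)).
by rewrite lee_fin polygon_length_ge0.
Qed.

Lemma curve_length_pt g a : curve_length g a a = 0%E.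
Proof.
apply/eqP; rewrite eq_le curve_length_ge0// andbT.
by apply: curve_length_le => p /itv_partitionxx ->; rewrite polygon_length_nil.
Qed.

Lemma eq_curve_length g g' a b : (forall t, a <= t <= b -> g t = g' t) ->
  curve_length g a b = curve_length g' a b.
Proof.
move=> gg'; apply/eqP; rewrite eq_le; apply/andP; split;
  apply: curve_length_le => p abp.
  by rewrite (eq_polygon_length abp gg') curve_length_ub.
by rewrite -(eq_polygon_length abp gg') curve_length_ub.
Qed.

(** A subdivision of [a, s] extended by t is a subdivision of [a, t], so the chord from g s to g t
    adds to the length. *)
Lemma curve_length_step g a s t : a <= s -> s <= t ->
  (curve_length g a s + (enorm (g t - g s))%:E <= curve_length g a t)%E.
Proof.
move=> as_; rewrite le_eqVlt => /predU1P[<-|st].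
  by rewrite subrr enorm0 adde0.
rewrite -leeBrDr//; apply: curve_length_le => p asp.
rewrite leeBrDr// -EFinD.
have lp : last a p = s by case: asp => _ /eqP.
rewrite -[X in g t - g X]lp -(polygon_length_rcons g t).
apply: curve_length_ub; case: asp => pp _.
by split; rewrite ?last_rcons// rcons_path pp lp.
Qed.

Lemma curve_length_lipschitz g a b :
  (forall s t, a <= s -> s <= t -> t <= b -> enorm (g t - g s) <= t - s) ->
  (curve_length g a b <= (b - a)%:E)%E.
Proof.
move=> gl; apply: curve_length_le => p abp.
by rewrite lee_fin polygon_length_lipschitz.
Qed.

Lemma curve_length_mono g a s t : a <= s -> s <= t ->
  (curve_length g a s <= curve_length g a t)%E.
Proof.
move=> as_ st; apply: le_trans (curve_length_step g as_ st).
by rewrite leeDl// lee_fin enorm_ge0.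
Qed.

End CurveLength.

(** * The integral of 1/d along an arc, and induction along an arc *)

Section ArcIntegral.
Context {R : realType} {n : nat}.
Implicit Types (D : set 'rV[R]_n) (g : R -> 'rV[R]_n).

Lemma ge0_integral_itv_split (f : R -> \bar R) (a b c : R) :
  a <= b -> b <= c -> measurable_fun `[a, c] f -> (forall t, (0 <= f t)%E) ->
  (\int[lebesgue_measure]_(t in `[a, c]) f t =
   \int[lebesgue_measure]_(t in `[a, b]) f t +
   \int[lebesgue_measure]_(t in `]b, c]) f t)%E.
Proof.
move=> ab bc mf f0.
have E : `[a, c]%classic = `[a, b] `|` `]b, c].
  by rewrite (itv_bndbnd_setU (x:=BRight b))// bnd_simp.
rewrite E ge0_integral_setU//; first by rewrite -E.
rewrite disj_set2E; apply/eqP/seteqP; split => r //= [].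
by rewrite !in_itv/= => /andP[_ h1] /andP[h2 _]; move: h2; rewrite ltNge h1.
Qed.

(** [J t] is the quasihyperbolic length of the part of the arc up to parameter t. While the arc
    stays within [bdist D (g s)] of g s, the density 1/d is at least 1/(2 d(g s)), and the length
    covered is at least the chord. *)
Lemma arc_integral_step D x y a b g : proper_subdomain D ->
  rectifiable_arc D x y a b g ->
  (qh_integral D g a b < +oo)%E ->
  exists J : R -> R, [/\ J a = 0,
    J b = fine (qh_integral D g a b) &
    forall s t, a <= s -> s <= t -> t <= b ->
      (forall r, s <= r <= t -> enorm (g s - g r) <= bdist D (g s)) ->
      enorm (g s - g t) <= 2 * bdist D (g s) * (J t - J s)].
Proof.
move=> pD [ab [cg _] Dg _ fl] Ioo.
pose l t := fine (curve_length g a t).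
have lE t : a <= t -> t <= b -> curve_length g a t = (l t)%:E.
  move=> at_ tb; rewrite fineK// ge0_fin_numE ?curve_length_ge0//.
  exact: le_lt_trans (curve_length_mono g at_ tb) fl.
have la : l a = 0 by rewrite /l curve_length_pt.
have lb : fine (curve_length g a b) = l b by [].
clearbody l; have lstep s t : a <= s -> s <= t -> t <= b -> l s + enorm (g t - g s) <= l t.
  move=> as_ st tb; rewrite -lee_fin EFinD -!lE//.
  - exact: curve_length_step.
  - exact: le_trans as_ st.
  - exact: le_trans st tb.
have lmono s t : a <= s -> s <= t -> t <= b -> l s <= l t.
  by move=> as_ st tb; rewrite (le_trans _ (lstep s t _ _ _))// lerDl enorm_ge0.
have l0 t : a <= t -> t <= b -> 0 <= l t by move=> *; rewrite -la lmono.
pose E s := [set t | t \in `[a, b] /\ (s%:E <= curve_length g a t)%E].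
(* Adding b makes the set nonempty for every real s, so [tau] is nondecreasing on the whole line
   with values in [a, b]. For s between 0 and the total length, b already belongs to [E s], and g
   (tau s) is the arc length parametrization. *)
pose tau s := inf (E s `|` [set b]).
have tau_lb s : has_lbound (E s `|` [set b]).
  by exists a => t [[/itvP h _]|->//]; rewrite h.
have tau_ge s : a <= tau s.
  apply: lb_le_inf; first by exists b; right.
  by move=> t [[/itvP h _]|->//]; rewrite h.
have tau_le s : tau s <= b by apply: ge_inf => //; right.
have tau_mono : nondecreasing_fun tau.
  move=> s s' ss'; apply: lb_le_inf; first by exists b; right.
  move=> t [[tab st]|->]; apply: ge_inf => //; last by right.
  by left; split => //; apply: le_trans st; rewrite lee_fin.
pose h s := (bdist D (g (tau s)))^-1.
have Dg' t : a <= t -> t <= b -> D (g t).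
  by move=> at_ tb; apply: Dg; rewrite in_itv/= at_.
have h0 s : 0 <= h s.
  by rewrite invr_ge0 ltW// bdist_gt0//; exact: Dg'.
(* [h] is a continuous function on [a, b] composed with the monotone [tau]. *)
have mh (A : set R) : measurable A -> measurable_fun A (EFin \o h).
  move=> mA; apply/measurable_EFinP.
  apply: (@measurable_comp _ _ _ _ _ _ `[a, b]%classic
    (fun t => (bdist D (g t))^-1)) => //.
  - by move=> _ [s _ <-]; rewrite /= in_itv/= tau_ge tau_le.
  - apply: subspace_continuous_measurable_fun => //.
    apply/subspace_continuousP => t /= tab.
    have gt : g @ within `[a, b] (nbhs t) --> g t.
      by move/subspace_continuousP : cg; apply.
    apply: cvgV; first by rewrite gt_eqF// bdist_gt0//; exact: Dg.
    apply: cvg_comp gt _; exact: bdist_continuous.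
  - exact: nondecreasing_measurable.
pose I t := (\int[lebesgue_measure]_(s in `[0%R, l t]) (h s)%:E)%E.
have Ib : I b = qh_integral D g a b.
  rewrite /arc_integral lb; apply: eq_integral => s.
  rewrite inE/= in_itv/= => /andP[s0 sl]; congr (_%:E); rewrite /h /tau /arclength_param; congr ((bdist D (g (inf _)))^-1).
  apply/seteqP; split => [t [//|->]|t]; last by left.
  by split; rewrite ?in_itv/= ?ab ?lexx// lE ?lee_fin.
have IE s t : a <= s -> s <= t -> t <= b ->
    (I t = I s + \int[lebesgue_measure]_(r in `]l s, l t]) (h r)%:E)%E.
  move=> as_ st tb; apply: ge0_integral_itv_split.
  - exact: l0 as_ (le_trans st tb).
  - exact: lmono.
  - by apply: mh; exact: measurable_itv.
  - by move=> r; rewrite lee_fin.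
have I0 t : (0 <= I t)%E by apply: integral_ge0 => s _; rewrite lee_fin.
have Ifin t : a <= t -> t <= b -> I t \is a fin_num.
  move=> at_ tb; rewrite (ge0_fin_numE (I0 t)).
  have Iboo : (I b < +oo)%E by rewrite Ib.
  apply: le_lt_trans Iboo.
  rewrite /I; apply: ge0_subset_integral.
  - exact: measurable_itv.
  - exact: measurable_itv.
  - by apply: mh; exact: measurable_itv.
  - by move=> s _; rewrite lee_fin.
  move=> s /=; rewrite !in_itv/= => /andP[-> sl] /=.
  exact: le_trans sl (lmono _ _ at_ tb (lexx b)).
have Ia : I a = 0%E by rewrite /I la set_itv1 integral_set1.
clearbody I; clear I0.
exists (fun t => fine (I t)); split; [by rewrite Ia|by rewrite Ib|].
move=> s t as_ st tb close.
have sb := le_trans st tb; have at_ := le_trans as_ st.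
have ds := bdist_gt0 pD (Dg' _ as_ sb).
have Ige : (((2 * bdist D (g s))^-1 * (l t - l s))%:E <=
    \int[lebesgue_measure]_(r in `]l s, l t]) (h r)%:E)%E.
  have -> : (((2 * bdist D (g s))^-1 * (l t - l s))%:E =
    \int[lebesgue_measure]_(r in `]l s, l t])
      (cst ((2 * bdist D (g s))^-1)%:E) r)%E.
    rewrite integral_cst//= lebesgue_measure_itv/= lte_fin.
    case: ltP => [_|h1]; first by rewrite EFinM.
    have -> : l t = l s by apply/le_anti; rewrite h1 lmono.
    by rewrite subrr mulr0 mule0.
  apply: ge0_le_integral => //.
  - by move=> r _; rewrite lee_fin invr_ge0 mulr_ge0// ltW.
  - exact: mh.
  - move=> r /=; rewrite in_itv/= => /andP[h1 h2]; rewrite lee_fin /h.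
    have tr : tau r <= t.
      apply: ge_inf => //; left; split; first by rewrite in_itv/= at_.
      by rewrite lE.
    (* Here r > l s strictly, the left end being open: a parameter q with l q >= r cannot lie before
       s, by monotonicity of l. *)
    have sr : s <= tau r.
      apply: lb_le_inf; first by exists b; right.
      move=> q [[/itvP qab]|->//]; rewrite lE ?qab// lee_fin => rq.
      rewrite leNgt; apply/negP => qs.
      have := lmono q s; rewrite qab ltW// => /(_ _ _ _) => h3.
      by move: (lt_le_trans h1 rq); rewrite ltNge h3// (le_trans st).
    have dr := bdist_gt0 pD (Dg' _ (tau_ge r) (tau_le r)).
    rewrite lef_pV2 ?posrE ?mulr_gt0//.
    have h3 : enorm (g s - g (tau r)) <= bdist D (g s) by apply: close; rewrite sr.
    have := bdist_lipschitz (g (tau r)) (g s) pD; rewrite enormB; lra.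
have h1 := lstep s t as_ st tb.
have h2 : (2 * bdist D (g s))^-1 * (l t - l s) <= fine (I t) - fine (I s).
  rewrite -lee_fin EFinB !fineK ?Ifin// (IE s t)//.
  by rewrite addeAC subee ?Ifin// add0e.
rewrite enormB; apply: (@le_trans _ _ (l t - l s)); first by lra.
move: h2; rewrite ler_pdivrMl// mulr_gt0//.
Qed.

(** Let r be the supremum of the parameters where P holds. Some such parameter lies within e of r,
    and the local step at r carries P from there to min(b, r + e/2), which exceeds r unless r =
    b. *)
Lemma interval_step_induction (a b : R) (P : R -> Prop) : a <= b -> P a ->
  (forall t, a <= t <= b -> exists2 e, 0 < e & forall r s, a <= r -> r <= s ->
     s <= b -> t - e < r -> s < t + e -> P r -> P s) ->
  P b.
Proof.
move=> ab Pa loc.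
pose E := [set t | a <= t <= b /\ P t].
have Ea : E a by split; rewrite ?lexx.
have hE : has_sup E by split; [exists a|exists b => t [/andP[]]].
pose r := sup E.
have ar : a <= r by apply: ub_le_sup => //; exact: hE.2.
have rb : r <= b by apply: ge_sup; [exists a|move=> t [/andP[]]].
have [|e e0 He] := loc r; first by rewrite ar.
have [t [/andP[at_ tb] Pt] rt] := sup_adherent e0 hE.
have tr : t <= r by apply: ub_le_sup; [exact: hE.2|split; rewrite ?at_].
pose s := Num.min b (r + e / 2).
have sb : s <= b by rewrite ge_min lexx.
have rs : r <= s by rewrite le_min rb; lra.
have se : s < r + e by rewrite gt_min; apply/orP; right; lra.
have Ps : P s by apply: (He t) => //; exact: le_trans rs.
have : s <= r.
  by apply: ub_le_sup; [exact: hE.2|split; rewrite ?sb ?(le_trans ar rs)].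
rewrite /s ge_min => /orP[br|]; last by lra.
suff -> : b = s by [].
by apply/le_anti; rewrite sb andbT (le_trans br).
Qed.

(** [S p k] is to be read as a property of the point p reached at cost k. It has to survive only
    short moves, of size at most c d(p), whose length is paid for by the increase of the cost. *)
Lemma arc_chain D x y a b g (c : R) (S : 'rV[R]_n -> R -> Prop) :
  proper_subdomain D -> rectifiable_arc D x y a b g ->
  (qh_integral D g a b < +oo)%E ->
  0 < c -> c <= 1 -> S x 0 ->
  (forall p q k k', D p -> D q -> S p k -> enorm (p - q) <= c * bdist D p ->
    enorm (p - q) <= 2 * bdist D p * (k' - k) -> S q k') ->
  S y (fine (qh_integral D g a b)).
Proof.
move=> pD arc Ioo c0 c1 Sx Sstep.
have [J [Ja <- Jstep]] := arc_integral_step pD arc Ioo.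
have [ab [cg _] Dg [ga gb] _] := arc.
rewrite -gb; apply: (@interval_step_induction a b (fun t => S (g t) (J t))) => //.
  by rewrite ga Ja.
move=> t tab; have Dt : D (g t) by apply: Dg; rewrite in_itv.
have dt := bdist_gt0 pD Dt.
(* Two points this close to g t are at most c d(g t)/2 apart, and d(g t) <= 2 d(g r), so their
   distance is at most c d(g r), as [Sstep] requires. *)
have e0 : 0 < c * bdist D (g t) / 4 by rewrite divr_gt0// mulr_gt0.
have gt : g @ within `[a, b] (nbhs t) --> g t.
  by move/subspace_continuousP : cg; apply; rewrite /= in_itv.
have /(@cvg_enormP _ _ _ _ _ _ _).1 := gt.
move=> /(_ _ e0); rewrite near_withinE => /nbhs_ballP[d /= d0 dP].
have close r : a <= r -> r <= b -> t - d < r -> r < t + d ->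
    enorm (g r - g t) < c * bdist D (g t) / 4.
  move=> ar rb tr rt; apply: dP; last by rewrite /= in_itv/= ar.
  by rewrite /ball/= ltr_norml; apply/andP; split; lra.
exists d => // r s ar rs sb tr st Sr.
have cr : enorm (g r - g t) < c * bdist D (g t) / 4 by apply: close; lra.
have ct : c * bdist D (g t) <= bdist D (g t) by rewrite ler_piMl// ltW.
have dr : bdist D (g t) <= 2 * bdist D (g r).
  by have := bdist_lipschitz (g t) (g r) pD; rewrite enormB; lra.
have cdr : c * bdist D (g t) <= 2 * (c * bdist D (g r)).
  by rewrite mulrCA ler_wpM2l// ltW.
have rq q : r <= q -> q <= s -> enorm (g r - g q) <= c * bdist D (g r).
  move=> rq qs; have cq : enorm (g q - g t) < c * bdist D (g t) / 4.
    by apply: close; lra.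
  by have := enorm_distD (g t) (g r) (g q); rewrite (enormB (g t)); lra.
apply: (Sstep (g r)) Sr _ _; [| |exact: rq|].
- by apply: Dg; rewrite in_itv/= ar; lra.
- by apply: Dg; rewrite in_itv/= sb andbT; lra.
- apply: Jstep => // q /andP[rq1 qs]; apply: le_trans (rq q rq1 qs) _.
  by rewrite ler_piMl// ltW// bdist_gt0//; apply: Dg; rewrite in_itv/= ar; lra.
Qed.

End ArcIntegral.

(** * Arcs of unit speed and their extension by a segment *)

Section UnitSpeedArcs.
Context {R : realType} {n : nat}.
Implicit Types (D : set 'rV[R]_n) (x y z : 'rV[R]_n) (g : R -> 'rV[R]_n).

(** The arc proper is g on [0, L]. The Lipschitz bound and the membership in D are required on the
    whole line so that g and 1/d along g are globally continuous, which spares restrictions to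
    subintervals. *)
Record unit_speed_arc D x y (L : R) g (K : R) : Prop := UnitSpeedArc {
  arc_len_ge0 : 0 <= L;
  arc_lipschitz : forall s t, s <= t -> enorm (g t - g s) <= t - s;
  arc_inj : {in `[0, L] &, injective g};
  arc_in : forall t, D (g t);
  arc_start : g 0 = x;
  arc_end : g L = y;
  arc_speed : forall t, 0 <= t -> t <= L -> curve_length g 0 t = t%:E;
  arc_cost : (\int[lebesgue_measure]_(s in `[0%R, L])
                ((bdist D (g s))^-1)%:E <= K%:E)%E }.

Definition qh_joined D x y K := exists L g, unit_speed_arc D x y L g K.

Lemma unit_lipschitz_continuous g :
  (forall s t, s <= t -> enorm (g t - g s) <= t - s) -> continuous g.
Proof.
move=> gl; apply: (@lipschitz_enorm_continuous _ _ _ 1) => s t; rewrite mul1r.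
have [st|/ltW ts] := leP s t.
  by rewrite enormB distrC ger0_norm ?subr_ge0// gl.
by rewrite ger0_norm ?subr_ge0// gl.
Qed.

Lemma measurable_inv_bdist D g (A : set R) : proper_subdomain D ->
  continuous g -> (forall t, D (g t)) ->
  measurable_fun A (EFin \o (fun s => (bdist D (g s))^-1)).
Proof.
move=> pD cg Dg; apply/measurable_EFinP/measurable_funTS.
apply: continuous_measurable_fun => t.
apply: cvgV; first by rewrite gt_eqF// bdist_gt0.
have gt : g @ t --> g t by exact: cg.
apply: cvg_comp gt _; exact: bdist_continuous.
Qed.

(** At unit speed, the first parameter at which the length reaches s is s itself, so
    [arclength_param] is g and the arc integral is the recorded cost. *)
Lemma qh_joined_dist D x y K : qh_joined D x y K -> (qh_dist D x y <= K%:E)%E.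
Proof.
move=> [L [g [L0 gl gi Dg g0 gL gs cost]]].
have cg := unit_lipschitz_continuous gl.
apply: le_trans cost; apply: ereal_inf_lbound; exists 0, L, g; split.
  split => //; first by split => //; exact: continuous_subspaceT.
  by rewrite gs ?ltry.
rewrite /arc_integral (gs L L0 (lexx L)) [fine _]/=; apply: eq_integral => s; rewrite inE/= in_itv/=.
move=> /andP[s0 sL]; congr ((bdist D _)^-1%:E).
rewrite /arclength_param; congr g; apply/esym/le_anti/andP; split.
  apply: ge_inf; first by exists 0 => t [/itvP h _]; rewrite h.
  by split; rewrite ?in_itv/= ?s0// gs.
apply: lb_le_inf; first by exists s; split; rewrite ?in_itv/= ?s0// gs.
by move=> t [/itvP h]; rewrite gs ?h// lee_fin.
Qed.

Lemma qh_joined_refl D x : D x -> qh_joined D x x 0.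
Proof.
move=> Dx; exists 0, (cst x); split => //=.
- by move=> s t st; rewrite subrr enorm0 subr_ge0.
- by move=> s t; rewrite !in_itv/= => /le_anti <- /le_anti <-.
- move=> t t0 t0'; have -> : t = 0 by apply/le_anti; rewrite t0 t0'.
  exact: curve_length_pt.
- by rewrite set_itv1 integral_set1.
Qed.

Lemma qh_joined_segment D x y z K (d : R) : proper_subdomain D ->
  0 < d -> (forall r, 0 <= r <= 1 ->
    D (y + r *: (z - y)) /\ d <= bdist D (y + r *: (z - y))) ->
  qh_joined D x y K -> qh_joined D x z (K + enorm (z - y) / d).
Proof.
move=> pD d0 Dseg [L [g [L0 gl gi Dg g0 gL gs cost]]].
have [zy|zy] := eqVneq z y.
  exists L, g; split => //; first by rewrite gL zy.
  by rewrite zy subrr enorm0 mul0r addr0.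
have cg := unit_lipschitz_continuous gl.
have e0 : 0 < enorm (z - y).
  rewrite lt_def enorm_ge0 andbT; apply: contra_neq zy => /enorm_eq0/eqP.
  by rewrite subr_eq0 => /eqP.
pose seg := (fun r : R => y + r *: (z - y)) @` `[0, 1].
(* The parameters at which the old arc meets the new segment. This set is compact and contains L, so
   it has a least element t0; the old arc is abandoned at t0 and the segment followed from g t0 to
   z. *)
pose E := `[0, L]%classic `&` g @^-1` seg.
have cseg : compact seg.
  apply: continuous_compact; last exact: segment_compact.
  apply: continuous_subspaceT.
  apply: (@lipschitz_enorm_continuous _ _ _ (enorm (z - y))) => s t.
  by rewrite opprD addrACA subrr add0r -scalerBl enormZ mulrC.
have cE : compact E.
  apply: (subclosed_compact _ (@segment_compact _ 0 L)); last by move=> ? [].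
  apply: closedI; first exact: itv_closed.
  apply: closed_comp; first by move=> ? _; exact: cg.
  by apply: compact_closed => //; exact: norm_hausdorff.
have EL : E L.
  split; first by rewrite /= in_itv/= L0 lexx.
  by exists 0; rewrite /= ?in_itv/= ?lexx ?ler01// scale0r addr0 gL.
have cid : {within E, continuous (id : R -> R)}.
  by apply: continuous_subspaceT => t; exact: cvg_id.
have [t0 /set_mem[/= + [r0 /=]]] :=
  @compact_EVT_min _ _ id E (ex_intro _ L EL) cE cid.
rewrite !in_itv/= => /andP[t00 t0L] /andP[r00 r01] gt0 t0min.
pose p := g t0; pose l := (1 - r0) * enorm (z - y).
pose e := (enorm (z - y))^-1 *: (z - y).
have ne : enorm e = 1.
  by rewrite /e enormZ ger0_norm ?invr_ge0 ?enorm_ge0// mulVf// gt_eqF.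
have ne0 : e == 0 = false.
  apply/negP => /eqP e_eq0; move: ne; rewrite e_eq0 enorm0 => /eqP.
  by rewrite eq_sym oner_eq0.
have l0 : 0 <= l by rewrite mulr_ge0 ?enorm_ge0// subr_ge0.
have pE r : p + r *: e = y + (r0 + r / enorm (z - y)) *: (z - y).
  by rewrite /p -gt0 /e scalerA scalerDl addrA.
have rE r : 0 <= r -> r <= l -> 0 <= r0 + r / enorm (z - y) <= 1.
  move=> h1 h2; rewrite addr_ge0//=; last by rewrite divr_ge0// ltW.
  by rewrite -lerBrDl ler_pdivrMr.
have pl : p + l *: e = z.
  rewrite pE /l mulfK ?gt_eqF// addrCA subrr addr0 scale1r.
  by rewrite addrC subrK.
(* Distance covered on the segment at time t, clamped to [0, l] so that the new path [h] is defined
   on the whole line, stays in D, and rests at z after time t0 + l. *)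
pose c t := Num.min (Num.max (t - t0) 0) l.
have c0 t : 0 <= c t by rewrite le_min l0 le_max lexx orbT.
have cl t : c t <= l by rewrite ge_min lexx orbT.
have c_left t : t <= t0 -> c t = 0.
  by move=> tt0; rewrite /c max_r ?subr_le0// min_l.
have c_mid t : t0 <= t -> t <= t0 + l -> c t = t - t0.
  by move=> tt0 tl; rewrite /c max_l ?subr_ge0// min_l// lerBlDl.
have c_lip s t : s <= t -> 0 <= c t - c s /\ (t0 <= s -> c t - c s <= t - s)
    /\ (c t <= Num.max (t - t0) 0).
  move=> st; rewrite /c; split.
    rewrite subr_ge0 le_min !ge_min lexx orbT andbT; apply/orP; left.
    by rewrite ge_max !le_max lexx orbT andbT lerB.
  split; last by rewrite ge_min lexx.
  move=> t0s; rewrite (max_l (x := s - t0)) ?subr_ge0//.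
  rewrite (max_l (x := t - t0)) ?subr_ge0 ?(le_trans t0s)//.
  by rewrite !minEle; case: ifPn; case: ifPn => //; rewrite -?ltNge; lra.
pose h t := g (Num.min t t0) + c t *: e.
have h_left t : t <= t0 -> h t = g t.
  by move=> tt0; rewrite /h min_l// c_left// scale0r addr0.
have h_right t : t0 <= t -> h t = p + c t *: e.
  by move=> tt0; rewrite /h min_r.
have hl s t : s <= t -> enorm (h t - h s) <= t - s.
  move=> st; have [c_ge0 [c_le ctt]] := c_lip s t st.
  rewrite /h opprD addrACA -scalerBl (le_trans (enormD _ _))//.
  rewrite enormZ ne mulr1 ger0_norm//.
  have [tt0|/ltW t0t] := leP t t0.
    by rewrite !min_l ?(le_trans st)// !c_left ?(le_trans st)// subrr addr0 gl.
  have [st0|/ltW t0s] := leP s t0.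
    have := gl s t0 st0; rewrite (c_left s)// subr0.
    by move: ctt; rewrite max_l ?subr_ge0//; lra.
  by rewrite subrr enorm0 add0r c_le.
have hseg t : t0 <= t -> h t = y + (r0 + c t / enorm (z - y)) *: (z - y).
  by move=> t0t; rewrite h_right// pE.
have Dh t : D (h t).
  have [tt0|/ltW t0t] := leP t t0; first by rewrite h_left.
  by rewrite hseg//; apply: (Dseg _ (rE _ (c0 t) (cl t))).1.
have ch := unit_lipschitz_continuous hl.
have L'0 : 0 <= t0 + l by rewrite addr_ge0.
(* A meeting would put s in [E], hence s = t0 by minimality; but at time t > t0 the path has moved
   off g t0 by c t = t - t0 > 0. *)
have cut s t : 0 <= s -> s <= t0 -> t0 < t -> t <= t0 + l -> h s <> h t.
  move=> s0 st0 t0t tl; have t0t' := ltW t0t; rewrite h_left// => hst.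
  have ts : t0 <= s.
    apply: t0min; apply/mem_set; split.
      by rewrite /= in_itv/= s0 (le_trans st0).
    exists (r0 + c t / enorm (z - y)); first by rewrite /= in_itv/= rE.
    by rewrite hst hseg.
  have es : s = t0 by apply/le_anti; rewrite st0.
  move: hst; rewrite es h_right// => /eqP.
  rewrite eq_sym -subr_eq0 addrAC subrr add0r scaler_eq0 ne0 orbF.
  by rewrite c_mid// subr_eq0 gt_eqF.
exists (t0 + l), h; split => //.
- move=> s t; rewrite !in_itv/= => /andP[s0 sl] /andP[t0' tl] hst.
  have [st0|t0s] := leP s t0; have [tt0|t0t] := leP t t0.
  + apply: gi; rewrite ?in_itv/= ?s0 ?t0' ?(le_trans st0) ?(le_trans tt0)//.
    by rewrite -!h_left.
  + by have := cut s t s0 st0 t0t tl.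
  + by have := cut t s t0' tt0 t0s sl; rewrite hst.
  + move: hst; rewrite !h_right ?ltW// => /addrI/eqP.
    rewrite -subr_eq0 -scalerBl scaler_eq0 ne0 orbF.
    by rewrite !c_mid ?(ltW t0s) ?(ltW t0t)// subr_eq0 => /eqP/addIr.
- by rewrite h_left.
- by rewrite h_right ?lerDl// c_mid ?lerDl// addrAC subrr add0r pl.
- move=> t tge0 tl; have [tt0|/ltW t0t] := leP t t0.
    rewrite -(gs t)// ?(le_trans tt0)//; apply: eq_curve_length => s /andP[_ st].
    by rewrite h_left// (le_trans st).
  (* The Lipschitz bound gives length at most t; the old arc up to t0 followed by one chord of the
     straight part gives at least t. *)
  apply/le_anti/andP; split.
    rewrite -[in leRHS](subr0 t); apply: curve_length_lipschitz => s s' _ ss' _.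
    exact: hl.
  apply: le_trans (curve_length_step h t00 t0t).
  have -> : curve_length h 0 t0 = t0%:E.
    rewrite -(gs t0)//; apply: eq_curve_length => s /andP[_ st]; exact: h_left.
  rewrite -EFinD lee_fin !h_right// (c_left t0)// scale0r addr0 addrAC subrr add0r.
  by rewrite enormZ ne mulr1 ger0_norm// c_mid// addrC subrK.
- have dh0 t : (0 <= ((bdist D (h t))^-1)%:E)%E.
    by rewrite lee_fin invr_ge0 ltW// bdist_gt0.
  rewrite (@ge0_integral_itv_split _ _ 0 t0 (t0 + l)) ?lerDl//; last first.
    exact: measurable_inv_bdist.
  rewrite EFinD; apply: leeD.
    apply: le_trans cost.
    have -> : (\int[lebesgue_measure]_(s in `[0%R, t0]) ((bdist D (h s))^-1)%:E =
        \int[lebesgue_measure]_(s in `[0%R, t0]) ((bdist D (g s))^-1)%:E)%E.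
      apply: eq_integral => s; rewrite inE/= in_itv/= => /andP[_ st].
      by rewrite h_left.
    apply: ge0_subset_integral => //=; first exact: measurable_inv_bdist.
      by move=> s _; rewrite lee_fin invr_ge0 ltW// bdist_gt0.
    move=> s /=; rewrite !in_itv/= => /andP[-> st] /=; exact: le_trans t0L.
  apply: (@le_trans _ _ (\int[lebesgue_measure]_(s in `]t0, (t0 + l)%R])
      (cst (d^-1)%:E) s)%E).
    apply: ge0_le_integral => //; first exact: measurable_inv_bdist.
    move=> s /=; rewrite in_itv/= => /andP[/ltW h1 h2]; rewrite lee_fin.
    rewrite lef_pV2 ?posrE ?bdist_gt0//.
    by rewrite hseg//; apply: (Dseg _ (rE _ (c0 s) (cl s))).2.
  rewrite integral_cst//= lebesgue_measure_itv/= lte_fin.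
  case: ltP => _; last by rewrite mule0 lee_fin divr_ge0// ltW.
  rewrite -EFinD -EFinM lee_fin addrAC subrr add0r mulrC ler_wpM2r ?invr_ge0 ?(ltW d0)//.
  by rewrite /l ler_piMl ?(ltW e0)// lerBlDr lerDl.
Qed.

End UnitSpeedArcs.

(** * Second differences and the maximum principle *)

Section SecondDifferences.
Context {R : realType} {n : nat}.
Implicit Types (f G : 'rV[R]_n -> R) (x y z m : 'rV[R]_n).

Definition second_diff f x (t : R) : R :=
  \sum_(i < n) (f (x + t *: basis_vec R i) + f (x - t *: basis_vec R i)
                - 2 * f x).

(** The Laplacian as the limit of [second_diff f x t] / t^2. For this form, linear combinations,
    quadratic terms and reflections are handled by algebra on differences, and a local maximum gives
    the sign at once. *)
Definition has_laplacian f x (L : R) : Prop := forall e, 0 < e ->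
  exists2 d, 0 < d & forall t, 0 < t -> t < d ->
    `|second_diff f x t - t ^+ 2 * L| <= e * t ^+ 2.

Lemma coord_shift x t i j :
  (x + t *: basis_vec R i) ord0 j = x ord0 j + t *+ (j == i).
Proof. by rewrite !mxE eqxx/=; case: eqP; rewrite ?mulr1 ?mulr0. Qed.

Lemma is_derive_line f x (v : 'rV[R]_n) (t : R) : derivable f (x + t *: v) v ->
  is_derive t (1 : R) (fun s => f (x + s *: v)) ('D_v f (x + t *: v)).
Proof.
move=> df.
have E : (fun h : R => h^-1 *: (f (x + (h *: (1 : R) + t) *: v) - f (x + t *: v)))
    = (fun h : R => h^-1 *: (f (h *: v + (x + t *: v)) - f (x + t *: v))).
  apply/funext => h; congr (_ *: (f _ - _)).
  by rewrite scalerDl [h *: 1]mulr1 addrCA.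
apply: DeriveDef; first by rewrite /derivable /= E.
by rewrite /derive /= E.
Qed.

(** The mean value theorem applied to the remainder [rho]: its derivative is the first-order error
    of [dphi] at 0, which is at most e |t| between 0 and t. *)
Lemma second_order_taylor (phi dphi : R -> R) (A b t e : R) :
  (forall s, `|s| <= `|t| -> is_derive s (1 : R) phi (dphi s)) ->
  (forall s, `|s| <= `|t| -> `|dphi s - b - s * A| <= e * `|s|) -> 0 <= e ->
  `|phi t - phi 0 - t * b - t ^+ 2 * (A / 2)| <= e * t ^+ 2.
Proof.
move=> dp dA e0.
pose rho s := phi s - phi 0 - s * b - s ^+ 2 * (A / 2).
have drho s : `|s| <= `|t| -> is_derive s (1 : R) rho (dphi s - b - s * A).
  move=> /dp ds.
  have -> : rho = phi - cst (phi 0) - b *: (id : R -> R)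
      - (A / 2) *: (id : R -> R) ^+ 2.
    by apply/funext => r; rewrite /rho !fctE /GRing.scale/=; ring.
  by apply: is_derive_eq; rewrite /GRing.scale/=; field.
have rho0 : rho 0 = 0 by rewrite /rho; ring.
have bound s : `|s| <= `|t| -> `|dphi s - b - s * A| <= e * `|t|.
  by move=> st; rewrite (le_trans (dA s st))// ler_wpM2l.
have key a c : a <= c -> (forall s, a <= s <= c -> `|s| <= `|t|) ->
    `|rho c - rho a| <= e * `|t| * (c - a).
  move=> ac hs.
  have [||s sac ->] := @MVT_segment R rho (fun s => dphi s - b - s * A) a c ac.
  - by move=> s; rewrite in_itv/= => /andP[/ltW h1 /ltW h2]; apply: drho;
      apply: hs; rewrite h1.
  - apply: derivable_within_continuous => s; rewrite in_itv/= => sac.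
    by have := drho s (hs s sac); case.
  rewrite normrM (ger0_norm (x := c - a)) ?subr_ge0// ler_wpM2r ?subr_ge0//.
  by apply: bound; apply: hs; move: sac; rewrite in_itv.
rewrite -[X in `|X|]/(rho t).
have [t0|/ltW t0] := leP 0 t.
  have := key 0 t t0; rewrite rho0 !subr0 (ger0_norm t0) expr2 mulrA; apply.
  by move=> s /andP[s0 st]; rewrite ger0_norm.
have := key t 0 t0; rewrite rho0 !sub0r normrN (ler0_norm t0) expr2.
rewrite -mulrA mulrNN; apply.
by move=> s /andP[ts s0]; rewrite ler0_norm// lerN2.
Qed.

Lemma C2_has_laplacian (D : set 'rV[R]_n) f x : open D -> D x -> C2_on D f ->
  has_laplacian f x (laplacian f x).
Proof.
move=> oD Dx C2f e e0.
have n1 : 0 < n%:R + 1 :> R by rewrite ltr_wpDl.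
(* The expansions at t and -t are added, so the first-order terms cancel and each of the n
   directions contributes an error 2 e' t^2; n + 1 keeps the divisor positive when n = 0. *)
pose e' := e / (n%:R + 1) / 2.
have e'0 : 0 < e' by rewrite !divr_gt0.
have dir i : exists2 d, 0 < d & forall t, `|t| < d ->
    `|f (x + t *: basis_vec R i) - f x - t * partial i f x
      - t ^+ 2 * (partial i (partial i f) x / 2)| <= e' * t ^+ 2.
  have [_ d1 d2] := C2f x Dx; have [dpi _] := d2 i i.
  set v := basis_vec R i in dpi *.
  have [d0 d00 Dd] := open_eball oD Dx.
  have [d' d'0 hd'] : exists2 d', 0 < d' & forall s, `|s| < d' ->
      `|partial i f (x + s *: v) - partial i f x
        - s * partial i (partial i f) x| <= e' * `|s|.
    have /cvgrPdist_le /(_ _ e'0) : h^-1 *: (partial i f (h *: v + x) - partial i f x)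
        @[h --> 0^'] --> partial i (partial i f) x by exact: dpi.
    rewrite near_withinE => /nbhs_ballP[d' /= d'0 hd']; exists d' => // s sd.
    have [->|s0] := eqVneq s 0.
      by rewrite scale0r addr0 subrr mul0r subr0 normr0 mulr0.
    have := hd' s; rewrite /ball/= sub0r normrN => /(_ sd s0).
    rewrite [s *: v + x]addrC -(ler_pM2r (x := `|s|)) ?normr_gt0// -normrM.
    set P := partial i f (x + s *: v); rewrite -normrN => h.
    apply: le_trans h; rewrite le_eqVlt; apply/orP; left; apply/eqP.
    by congr `|_|; rewrite /GRing.scale/=; field.
  have ev : enorm v <= 1.
    rewrite /enorm (bigD1 i)//= big1 ?addr0.
      by rewrite mxE !eqxx expr1n sqrtr1.
    by move=> j ji; rewrite mxE eqxx/= (negbTE ji) expr0n.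
  exists (Num.min d0 d'); first by rewrite lt_min d00.
  move=> t; rewrite lt_min => /andP[td0 td'].
  have := @second_order_taylor (fun s => f (x + s *: v))
    (fun s => partial i f (x + s *: v)) (partial i (partial i f) x)
    (partial i f x) t e'.
  rewrite scale0r addr0; apply; last exact: ltW.
    move=> s st; apply: is_derive_line; have [|_ + _] := C2f (x + s *: v).
      apply: Dd; rewrite opprD addrA subrr add0r enormN enormZ.
      rewrite (le_lt_trans _ (le_lt_trans st td0))//.
      by rewrite -[leRHS]mulr1 ler_wpM2l.
    by move=> /(_ i)[].
  by move=> s st; apply: hd'; exact: le_lt_trans td'.
have [d d0 hd] : exists2 d, 0 < d & forall t i, `|t| < d ->
    `|f (x + t *: basis_vec R i) - f x - t * partial i f x
      - t ^+ 2 * (partial i (partial i f) x / 2)| <= e' * t ^+ 2.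
  have [d hd] := choice (fun i => let: ex_intro2 d d0 hd := dir i in
    ex_intro (fun d => 0 < d /\ forall t, `|t| < d -> 
    `|f (x + t *: basis_vec R i) - f x - t * partial i f x
      - t ^+ 2 * (partial i (partial i f) x / 2)| <= e' * t ^+ 2) d (conj d0 hd)).
  exists (\big[Num.min/1]_(i < n) d i).
    by apply: lt_bigmin => // i _; exact: (hd i).1.
  move=> t i ti; apply: (hd i).2; apply: lt_le_trans ti _.
  exact: bigmin_le.
exists d => // t t0 td; rewrite /second_diff /laplacian mulr_sumr -sumrB.
apply: (le_trans (ler_norm_sum _ _ _)).
apply: (@le_trans _ _ (\sum_(i < n) 2 * e' * t ^+ 2)).
  apply: ler_sum => i _.
  have h1 := hd t i; have h2 := hd (- t) i.
  rewrite normrN gtr0_norm// in h1 h2.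
  have {h1} := h1 td; have {h2} := h2 td; rewrite scaleNr sqrrN !ler_norml.
  by move=> /andP[h1 h2] /andP[h3 h4]; apply/andP; split; lra.
rewrite sumr_const card_ord -[leLHS]mulr_natl mulrA ler_wpM2r ?sqr_ge0//.
rewrite /e' (_ : n%:R * _ = e * (n%:R / (n%:R + 1))); last by field; rewrite gt_eqF.
by rewrite -[leRHS]mulr1 ler_wpM2l ?(ltW e0)// ler_pdivrMr// mul1r lerDl.
Qed.

(** The three base points are independent so that f at a point can be combined with f at the
    reflected point; c absorbs the exact second differences of quadratic terms. *)
Lemma has_laplacian_comb f g G x y z (a b c L M : R) :
  has_laplacian f x L -> has_laplacian g y M ->
  (forall t, second_diff G z t =
     a * second_diff f x t + b * second_diff g y t + t ^+ 2 * c) ->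
  has_laplacian G z (a * L + b * M + c).
Proof.
move=> hf hg GE e e0.
have p0 : 0 < `|a| + `|b| + 1 by rewrite ltr_wpDl// addr_ge0.
pose e' := e / (`|a| + `|b| + 1).
have e'0 : 0 < e' by rewrite divr_gt0.
have [d d0 hd] := hf e' e'0; have [d' d'0 hd'] := hg e' e'0.
exists (Num.min d d'); first by rewrite lt_min d0.
move=> t t0; rewrite lt_min => /andP[td td']; rewrite GE.
have -> : a * second_diff f x t + b * second_diff g y t + t ^+ 2 * c
    - t ^+ 2 * (a * L + b * M + c) = a * (second_diff f x t - t ^+ 2 * L)
    + b * (second_diff g y t - t ^+ 2 * M) by ring.
rewrite (le_trans (ler_normD _ _))// !normrM.
apply: (@le_trans _ _ (`|a| * (e' * t ^+ 2) + `|b| * (e' * t ^+ 2))).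
  by rewrite lerD// ler_wpM2l// ?hd ?hd'.
rewrite -mulrDl mulrA ler_wpM2r ?sqr_ge0//.
by rewrite /e' mulrC mulrAC ler_pdivrMr// ler_wpM2l ?(ltW e0)// lerDl.
Qed.

Lemma has_laplacian_local_max G z L : has_laplacian G z L ->
  (exists2 d, 0 < d & forall t i, 0 < t -> t < d ->
    G (z + t *: basis_vec R i) <= G z /\ G (z - t *: basis_vec R i) <= G z) ->
  L <= 0.
Proof.
move=> GL [d d0 Gmax]; rewrite leNgt; apply/negP => L0.
have [|d' d'0 hd'] := GL (L / 2); first by rewrite divr_gt0.
pose t := Num.min d d' / 2.
have m0 : 0 < Num.min d d' by rewrite lt_min d0.
have t0 : 0 < t by rewrite divr_gt0.
have [td td'] : t < d /\ t < d'.
  by apply/andP; rewrite -lt_min /t; lra.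
have t2 : 0 < t ^+ 2 by rewrite exprn_gt0.
have := hd' t t0 td'; rewrite ler_norml => /andP[+ _].
have : second_diff G z t <= 0.
  apply: sumr_le0 => i _; have [] := Gmax t i t0 td; lra.
have : 0 < L / 2 * t ^+ 2 by rewrite mulr_gt0// divr_gt0.
by rewrite (mulrC _ L); lra.
Qed.

(** The maximum over the compact box is attained. At an interior point the second differences would
    be nonpositive for small t, against the strictly positive Laplacian, so it is attained on a
    face. *)
Lemma max_principle (lo hi : 'I_n -> R) G (B : R) :
  let box := [set z : 'rV[R]_n | forall i, lo i <= z ord0 i <= hi i] in
  (forall z, box z -> {for z, continuous G}) ->
  (forall z, (forall i, lo i < z ord0 i < hi i) ->
     exists2 L, 0 < L & has_laplacian G z L) ->
  (forall z i, box z -> z ord0 i = lo i \/ z ord0 i = hi i -> G z <= B) ->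
  forall z, box z -> G z <= B.
Proof.
move=> box cG GL bd z bz.
have cbox : compact box.
  have -> : box =
      [set w : 'rV[R]_n | forall i, `[lo i, hi i]%classic (w ord0 i)].
    by apply/seteqP; split => w /= h i; have := h i; rewrite in_itv.
  by apply: (@rV_compact R n (fun i => `[lo i, hi i]%classic)) => i;
    exact: segment_compact.
have wG : {within box, continuous G}.
  by apply/subspace_continuousP => w bw; apply: cvg_within_filter; exact: cG.
have [w /set_mem bw wmax] := EVT_max_rV (ex_intro _ z bz) cbox wG.
apply: (@le_trans _ _ (G w)); first by apply: wmax; exact/mem_set.
have [[i wi]|nbd] := pselect (exists i, w ord0 i = lo i \/ w ord0 i = hi i).
  exact: bd wi.
have {nbd} win i : lo i < w ord0 i < hi i.
  have /andP[h1 h2] := bw i; rewrite !lt_neqAle h1 h2 !andbT.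
  apply/andP; split; apply/eqP => h; apply: nbd; exists i; [left|right] => //.
have [L L0 /has_laplacian_local_max] := GL w win.
rewrite leNgt L0 => h; exfalso; suff: false by []; apply: h.
pose d := \big[Num.min/1]_(i < n) Num.min (w ord0 i - lo i) (hi i - w ord0 i).
exists d.
  apply: lt_bigmin => // i _; have /andP[h1 h2] := win i.
  by rewrite lt_min !subr_gt0 h1.
move=> t i t0 td.
have tlh j : t <= w ord0 j - lo j /\ t <= hi j - w ord0 j.
  by apply/andP; rewrite -le_min (le_trans (ltW td))//; exact: bigmin_le.
rewrite -scaleNr.
split; apply: wmax; apply/mem_set => j; rewrite coord_shift;
  have [] := tlh j; have /andP[] := bw j; case: eqP => _;
  rewrite ?mulr1n ?mulr0n => *; apply/andP; split; lra.
Qed.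

End SecondDifferences.

(** * Interior estimates in terms of the oscillation *)

Section InteriorEstimates.
Context {R : realType} {n : nat}.
Implicit Types (f lap : 'rV[R]_n -> R) (x y z m : 'rV[R]_n).

Lemma enormB_continuous m : continuous (fun z : 'rV[R]_n => enorm (z - m)).
Proof.
move=> x; apply/(@cvgrPdist_lt _ _ _ (nbhs x)) => e e0; near=> y.
have xy : enorm (y - x) < e by near: y; exact: near_enorm.
apply: le_lt_trans xy; rewrite distrC (le_trans (enorm_lipschitz _ _))//.
by rewrite opprB addrA subrK.
Unshelve. all: by end_near. Qed.

Lemma coord_rV_continuous (k : 'I_n) :
  continuous (fun z : 'rV[R]_n => z ord0 k).
Proof. exact: coord_continuous. Qed.

Lemma second_diff_sqr_enorm m z t :
  second_diff (fun w => enorm (w - m) ^+ 2) z t = t ^+ 2 * (2 * n%:R).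
Proof.
transitivity (\sum_(i < n) 2 * t ^+ 2); last first.
  by rewrite sumr_const card_ord -[LHS]mulr_natr; ring.
apply: eq_bigr => i _; rewrite !sqr_enorm mulr_sumr -big_split -sumrB/=.
rewrite (bigD1 i)//= big1 => [|j ji]; rewrite -scaleNr !mxE eqxx/=.
  by rewrite ?eqxx ?mulr1 ?addr0; ring.
by rewrite (negbTE ji)/= !mulr0; ring.
Qed.

Lemma second_diff_parabola m z (k : 'I_n) d t :
  second_diff (fun w => (w ord0 k - m ord0 k) * (d - (w ord0 k - m ord0 k))) z t
  = t ^+ 2 * - 2.
Proof.
rewrite /second_diff (bigD1 k)//= big1 => [|j jk]; rewrite -scaleNr !coord_shift.
  by rewrite eqxx !mulr1n addr0; ring.
by rewrite eq_sym (negbTE jk) !mulr0n; ring.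
Qed.

Definition reflect m (k : 'I_n) z :=
  z - (2 * (z ord0 k - m ord0 k)) *: basis_vec R k.

Lemma reflect_coord m k z i : reflect m k z ord0 i =
  if i == k then 2 * m ord0 k - z ord0 k else z ord0 i.
Proof.
rewrite /reflect -scaleNr coord_shift; case: eqP => [->|_].
  by rewrite mulr1n; ring.
by rewrite mulr0n addr0.
Qed.

(** The reflection in the hyperplane z_k = m_k exchanges the two neighbours in direction k and
    commutes with the shifts in the other directions. *)
Lemma second_diff_reflect f m k z t :
  second_diff (f \o reflect m k) z t = second_diff f (reflect m k z) t.
Proof.
apply: eq_bigr => i _; have [->|ik] := eqVneq i k => /=.
  have E s : reflect m k (z + s *: basis_vec R k) =
      reflect m k z + (- s) *: basis_vec R k.
    apply/rowP => j; rewrite coord_shift !reflect_coord !coord_shift eqxx.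
    by case: eqP => _; rewrite ?mulr1n ?mulr0n; ring.
  by rewrite -scaleNr !E opprK; congr (_ - _); rewrite [LHS]addrC.
have E s : reflect m k (z + s *: basis_vec R i) =
    reflect m k z + s *: basis_vec R i.
  apply/rowP => j; rewrite coord_shift !reflect_coord !coord_shift.
  have [->|] := eqVneq j k; last by [].
  by rewrite eq_sym (negbTE ik) !mulr0n !addr0.
by rewrite -scaleNr !E.
Qed.

Lemma reflect_continuous m k : continuous (reflect m k).
Proof.
move=> x; apply/(@cvg_enormP _ _ _ (nbhs x)) => e e0; near=> y.
have xy : enorm (y - x) < e by near: y; exact: near_enorm.
suff -> : enorm (reflect m k y - reflect m k x) = enorm (y - x) by [].
congr Num.sqrt; apply: eq_bigr => i _; rewrite !mxE -!/(reflect _ _ _ _ _).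
by have := reflect_coord m k y i; have := reflect_coord m k x i;
  rewrite !mxE => -> ->; case: eqP => [->|_]; ring.
Unshelve. all: by end_near. Qed.

(* Comparison on the half cube {0 <= z_k - m_k <= d, |z_i - m_i| <= d} of the
   odd part of f in the k-th direction with the supersolution
   (M/d^2) |z - m|^2 + (nM/d^2 + N/2) s (d - s), where s = z_k - m_k. *)
Lemma axis_estimate f lap m (k : 'I_n) (d M N c : R) : 0 < d -> 0 <= M ->
  (forall z, (forall i, `|z ord0 i - m ord0 i| <= d) ->
    [/\ {for z, continuous f}, has_laplacian f z (lap z),
        `|lap z| < N & `|f z - c| <= M]) ->
  forall t, 0 <= t -> t <= d ->
    f (m + t *: basis_vec R k) - f (m - t *: basis_vec R k) <=
    2 * t * ((n%:R * M / d ^+ 2 + N / 2) * d).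
Proof.
move=> d0 M0 Hf t t0 td.
pose gam := n%:R * M / d ^+ 2 + N / 2.
have n1 : 1 <= n%:R :> R by rewrite ler1n (leq_ltn_trans _ (ltn_ord k)).
have N0 : 0 < N.
  have [|_ _ lN _] := Hf m; first by move=> i; rewrite subrr normr0 ltW.
  exact: le_lt_trans lN.
have d2 : 0 < d ^+ 2 by rewrite exprn_gt0.
have Md : 0 <= M / d ^+ 2 by rewrite divr_ge0// ltW.
have gamM : M / d ^+ 2 <= gam.
  by rewrite /gam -mulrA; have := ler_wpM2r Md n1; rewrite mul1r; lra.
have gam0 : 0 <= gam by exact: le_trans gamM.
pose s z := z ord0 k - m ord0 k.
pose psi z := M / d ^+ 2 * enorm (z - m) ^+ 2 + gam * (s z * (d - s z)).
pose G z := 2^-1 * f z - 2^-1 * f (reflect m k z) - psi z.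
pose lo i := if i == k then m ord0 k else m ord0 i - d.
pose hi i := m ord0 i + d.
have cube z : (forall i, lo i <= z ord0 i <= hi i) ->
    forall i, `|z ord0 i - m ord0 i| <= d.
  move=> zb i; have := zb i; rewrite /lo /hi ler_norml.
  by case: eqP => [->|_] /andP[h1 h2]; apply/andP; split; lra.
have rcube z : (forall i, `|z ord0 i - m ord0 i| <= d) ->
    forall i, `|reflect m k z ord0 i - m ord0 i| <= d.
  move=> zb i; rewrite reflect_coord; case: eqP => // ->.
  by rewrite -normrN; have := zb k; congr (`|_| <= _); ring.
have Gmain : forall z, (forall i, lo i <= z ord0 i <= hi i) -> G z <= 0.
  apply: max_principle => /=.
  - move=> z /cube zb; have [cf _ _ _] := Hf z zb.
    have [cf' _ _ _] := Hf _ (rcube z zb).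
    have cs : s @ z --> s z.
      exact: cvgB (@coord_rV_continuous k z) (cvg_cst _).
    have cr : (f \o reflect m k) @ z --> f (reflect m k z).
      exact: (continuous_comp (@reflect_continuous m k z) cf').
    have ce := @enormB_continuous m z.
    have cpsi : psi @ z --> psi z.
      apply: cvgD (cvgM (cvg_cst _) (cvgM ce ce)) _.
      exact: cvgM (cvg_cst _) (cvgM cs (cvgB (cvg_cst _) cs)).
    exact: cvgB (cvgB (cvgM (cvg_cst _) cf) (cvgM (cvg_cst _) cr)) cpsi.
  - move=> z zb; have {}zb : forall i, lo i <= z ord0 i <= hi i.
      by move=> i; have /andP[h1 h2] := zb i; rewrite !ltW.
    have [_ hl lN _] := Hf z (cube z zb).
    have [_ hl' lN' _] := Hf _ (rcube z (cube z zb)).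
    (* [psi] has Laplacian 2nM/d^2 - 2 gam = -N exactly, which is how [gam] is chosen; the odd part
       has Laplacian > -N because |lap| < N strictly. *)
    exists (2^-1 * lap z + (- 2^-1) * lap (reflect m k z) + N).
      move: lN lN'; rewrite !ltr_norml => /andP[h1 h2] /andP[h3 h4]; lra.
    apply: (has_laplacian_comb hl hl') => r.
    rewrite -(second_diff_reflect f).
    transitivity (2^-1 * second_diff f z r
      + (- 2^-1) * second_diff (f \o reflect m k) z r
      - (M / d ^+ 2 * second_diff (fun w => enorm (w - m) ^+ 2) z r
         + gam * second_diff (fun w => s w * (d - s w)) z r)).
      rewrite /second_diff !mulr_sumr -!big_split -sumrB/=.
      by apply: eq_bigr => i _; rewrite /G /psi; ring.
    rewrite second_diff_sqr_enorm second_diff_parabola /gam.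
    by field; rewrite gt_eqF.
  - move=> z i zb zi; have zc := cube z zb.
    have [_ _ _ fz] := Hf z zc.
    have [_ _ _ fz'] := Hf _ (rcube z zc).
    have [s0 sd] : 0 <= s z /\ s z <= d.
      by have := zb k; rewrite /lo /hi eqxx /s => /andP[h1 h2]; split; lra.
    have e0 : 0 <= M / d ^+ 2 * enorm (z - m) ^+ 2 by rewrite mulr_ge0 ?sqr_ge0.
    have p0 : 0 <= gam * (s z * (d - s z)).
      by rewrite !mulr_ge0// subr_ge0.
    (* On the face z_k = m_k the odd part vanishes. On every other face |z - m| >= d, so the first
       term of [psi] is at least M, which dominates the odd part. *)
    have [ik|far] : (i = k /\ z ord0 i = lo i) \/ `|z ord0 i - m ord0 i| = d.
      case: zi; rewrite /lo /hi.
        case: eqP => [-> ->|_ ->]; first by left.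
        by right; rewrite addrAC subrr add0r normrN gtr0_norm.
      by move=> ->; right; rewrite addrAC subrr add0r gtr0_norm.
    + have rz : reflect m k z = z.
        apply/rowP => j; rewrite reflect_coord; case: eqP => // ->.
        by case: ik => {}ik; rewrite /lo ik eqxx => ->; ring.
      by rewrite /G /psi rz subrr; lra.
    + have : M <= M / d ^+ 2 * enorm (z - m) ^+ 2.
        rewrite mulrAC ler_pdivlMr// ler_wpM2l// -far.
        rewrite ler_pXn2r ?nnegrE ?enorm_ge0//.
        by have := coord_le_enorm (z - m) i; rewrite !mxE.
      move: fz fz'; rewrite /G /psi !ler_norml => /andP[h1 h2] /andP[h3 h4]; lra.
have := Gmain (m + t *: basis_vec R k).
have rm : reflect m k (m + t *: basis_vec R k) = m - t *: basis_vec R k.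
  apply/rowP => i; rewrite -scaleNr reflect_coord !coord_shift eqxx.
  by case: eqP => [->|_]; rewrite ?mulr1n ?mulr0n; ring.
have st : s (m + t *: basis_vec R k) = t.
  by rewrite /s coord_shift eqxx mulr1n; ring.
rewrite /G /psi rm st => /(_ _) h.
have {h} := h _.
have -> : enorm (m + t *: basis_vec R k - m) ^+ 2 = t ^+ 2.
  rewrite addrAC subrr add0r sqr_enorm (bigD1 k)//= big1 => [|j jk].
    by rewrite !mxE !eqxx mulr1 addr0.
  by rewrite !mxE eqxx (negbTE jk) mulr0 expr0n.
move=> h.
have {}h : 2^-1 * f (m + t *: basis_vec R k) - 2^-1 * f (m - t *: basis_vec R k) -
   (M / d ^+ 2 * t ^+ 2 + gam * (t * (d - t))) <= 0.
  apply: h => i; rewrite coord_shift /lo /hi; case: eqP => [->|_].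
    by rewrite mulr1n lerDl t0 lerD2l.
  by rewrite mulr0n addr0 gerBl lerDl ltW.
(* This turns [psi] on the axis into at most gam t^2 + gam t (d - t) = gam t d, which is linear in
   t. *)
have : M / d ^+ 2 * t ^+ 2 <= gam * t ^+ 2 by rewrite ler_wpM2r ?sqr_ge0.
rewrite -/gam; lra.
Qed.

Lemma has_laplacianN f z L : has_laplacian f z L ->
  has_laplacian (fun w => - f w) z (- L).
Proof.
move=> fL; have -> : - L = -1 * L + 0 * L + 0 by ring.
apply: (has_laplacian_comb fL fL) => t.
rewrite mul0r mulr0 !addr0 /second_diff mulr_sumr; apply: eq_bigr => i _; ring.
Qed.

Lemma axis_estimate_norm f lap m (k : 'I_n) (d M N c : R) : 0 < d -> 0 <= M ->
  (forall z, (forall i, `|z ord0 i - m ord0 i| <= d) ->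
    [/\ {for z, continuous f}, has_laplacian f z (lap z),
        `|lap z| < N & `|f z - c| <= M]) ->
  forall t, `|t| <= d ->
    `|f (m + t *: basis_vec R k) - f (m - t *: basis_vec R k)| <=
    2 * `|t| * ((n%:R * M / d ^+ 2 + N / 2) * d).
Proof.
move=> d0 M0 Hf.
have HNf : forall z, (forall i, `|z ord0 i - m ord0 i| <= d) ->
    [/\ {for z, continuous (fun w => - f w)},
      has_laplacian (fun w => - f w) z (- lap z), `|- lap z| < N &
      `|- f z - (- c)| <= M].
  move=> z /Hf[cf fl lN fM]; split.
  - exact: cvgN cf.
  - exact: has_laplacianN.
  - by rewrite normrN.
  - by rewrite -opprD normrN.
have pos t : 0 <= t -> t <= d ->
    `|f (m + t *: basis_vec R k) - f (m - t *: basis_vec R k)| <=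
    2 * t * ((n%:R * M / d ^+ 2 + N / 2) * d).
  move=> t0 td; rewrite ler_norml (axis_estimate k d0 M0 Hf)// andbT.
  have := axis_estimate k d0 M0 HNf t0 td; lra.
move=> t; have [t0|/ltW t0] := leP 0 t; first by rewrite ger0_norm//; exact: pos.
rewrite ler0_norm// => td; have := pos (- t) _ td; rewrite oppr_ge0 => /(_ t0).
by rewrite scaleNr opprK distrC.
Qed.

(* If |f x| > 2M then f keeps its sign and f - kappa |z - x|^2 is strictly
   subharmonic for kappa = lam |f x| / (8n), so its maximum over the cube is on
   the boundary, which forces kappa r^2 <= M. *)
Lemma eigenvalue_bound f x (r M lam : R) : 0 < r -> 0 <= lam -> 0 <= M ->
  (0 < n)%N ->
  (forall z, (forall i, `|z ord0 i - x ord0 i| <= r) ->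
    [/\ {for z, continuous f}, has_laplacian f z (lam * f z)
      & `|f z - f x| <= M]) ->
  2 * M < f x -> lam * f x <= 8 * n%:R * M / r ^+ 2.
Proof.
move=> r0 lam0 M0 n0 Hf fx.
have r2 : 0 < r ^+ 2 by rewrite exprn_gt0.
have n0' : 0 < n%:R :> R by rewrite ltr0n.
pose kap := lam * f x / (8 * n%:R).
suff : kap * r ^+ 2 <= M.
  by rewrite /kap mulrAC ler_pdivrMr ?mulr_gt0// ler_pdivlMr// [M * _]mulrC.
rewrite leNgt; apply/negP => Mk.
have kap0 : 0 < kap by rewrite -(pmulr_lgt0 _ r2); exact: le_lt_trans Mk.
have kapE : 8 * n%:R * kap = lam * f x by rewrite /kap; field; rewrite gt_eqF.
have nk : 0 < n%:R * kap by rewrite mulr_gt0.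
pose G z := f z - kap * enorm (z - x) ^+ 2.
have cubeE z : (forall i, x ord0 i - r <= z ord0 i <= x ord0 i + r) ->
    forall i, `|z ord0 i - x ord0 i| <= r.
  by move=> zb i; have /andP[h1 h2] := zb i; rewrite ler_norml; apply/andP; split; lra.
have Gmain : forall z, (forall i, x ord0 i - r <= z ord0 i <= x ord0 i + r) ->
    G z <= f x + M - kap * r ^+ 2.
  apply: max_principle => /=.
  - move=> z /cubeE /Hf[cf _ _]; have ce := @enormB_continuous x z.
    exact: cvgB cf (cvgM (cvg_cst _) (cvgM ce ce)).
  - move=> z zb; have {}zb : forall i, x ord0 i - r <= z ord0 i <= x ord0 i + r.
      by move=> i; have /andP[h1 h2] := zb i; rewrite !ltW.
    have [_ fl fM] := Hf z (cubeE z zb).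
    exists (1 * (lam * f z) + 0 * (lam * f z) + - (2 * n%:R * kap)).
      (* From f z >= f x - M >= f x / 2. Hence lam f z >= 4n kap, twice the Laplacian 2n kap of the
         subtracted quadratic. *)
      have : lam * f x <= 2 * (lam * f z).
        rewrite mulrCA ler_wpM2l//; move: fM; rewrite ler_norml => /andP[h _]; lra.
      by rewrite -kapE; lra.
    apply: (has_laplacian_comb fl fl) => t.
    transitivity (second_diff f z t
        - kap * second_diff (fun w => enorm (w - x) ^+ 2) z t).
      rewrite /second_diff mulr_sumr -sumrB; apply: eq_bigr => i _.
      by rewrite /G; ring.
    by rewrite second_diff_sqr_enorm; ring.
  - move=> z i zb zi; have [_ _ fM] := Hf z (cubeE z zb).
    have far : `|z ord0 i - x ord0 i| = r.
      by case: zi => ->; rewrite addrAC subrr add0r ?normrN gtr0_norm.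
    have : r ^+ 2 <= enorm (z - x) ^+ 2.
      rewrite -far ler_pXn2r ?nnegrE ?enorm_ge0//.
      by have := coord_le_enorm (z - x) i; rewrite !mxE.
    move=> /(ler_wpM2l (ltW kap0)); move: fM; rewrite /G ler_norml.
    by move=> /andP[h1 h2]; lra.
have := Gmain x; rewrite /G subrr enorm0 => h.
have {}h : f x - kap * 0 ^+ 2 <= f x + M - kap * r ^+ 2.
  by apply: h => i; rewrite gerBl lerDl ltW.
by move: h; rewrite expr0n mulr0; lra.
Qed.

(** If |f x| <= 2M the bound on lam |f x| is immediate; otherwise [eigenvalue_bound] applies to f or
    to -f. Passing from x to z costs one more lam M, whence 3 lam, and r <= 1 allows M to be
    replaced by M / r^2. *)
Lemma eigen_laplacian_bound f x (r M lam : R) : 0 < r -> r <= 1 -> 0 <= lam ->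
  0 <= M -> (0 < n)%N ->
  (forall z, (forall i, `|z ord0 i - x ord0 i| <= r) ->
    [/\ {for z, continuous f}, has_laplacian f z (lam * f z)
      & `|f z - f x| <= M]) ->
  forall z, (forall i, `|z ord0 i - x ord0 i| <= r) ->
    `|lam * f z| <= (8 * n%:R + 3 * lam) * (M / r ^+ 2).
Proof.
move=> r0 r1 lam0 M0 n0 Hf z zb.
have r2 : 0 < r ^+ 2 by rewrite exprn_gt0.
have MM : M <= M / r ^+ 2.
  by rewrite ler_pdivlMr// ler_piMr// expr_le1// ltW.
have M'0 : 0 <= M / r ^+ 2 by exact: le_trans MM.
have lM : lam * M <= lam * (M / r ^+ 2) by rewrite ler_wpM2l.
have nM : 0 <= n%:R * (M / r ^+ 2) by rewrite mulr_ge0.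
have big : lam * `|f x| <= 8 * n%:R * (M / r ^+ 2) + 2 * lam * (M / r ^+ 2).
  have [h|h] := leP `|f x| (2 * M).
    by have := ler_wpM2l lam0 h; lra.
  suff : lam * `|f x| <= 8 * n%:R * M / r ^+ 2.
    by rewrite -mulrA => /le_trans; apply; have := mulr_ge0 lam0 M0; lra.
  have [fx|/ltW fx] := leP 0 (f x).
    by move: h; rewrite ger0_norm// => h; exact: (eigenvalue_bound r0 lam0 M0 n0 Hf).
  move: h; rewrite ler0_norm// => h.
  apply: (@eigenvalue_bound (fun w => - f w)) => // w wb.
  have [cf fl fM] := Hf w wb; split.
  - exact: cvgN cf.
  - by rewrite mulrN; exact: has_laplacianN.
  - by rewrite -opprD normrN.
have [_ _ fM] := Hf z zb.
rewrite normrM ger0_norm//.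
have h : `|f z| <= `|f x| + M.
  rewrite -[f z](subrK (f x)) addrC (le_trans (ler_normD _ _))// lerD2l//.
have := ler_wpM2l lam0 h; rewrite mulrDr; lra.
Qed.

(** The coordinates of x are changed into those of y one at a time. Each change is a move along one
    axis, symmetric about its midpoint, to which the odd-part estimate applies. *)
Lemma eigen_lipschitz f x (r M lam : R) : 0 < r -> r <= 1 -> 0 <= lam ->
  0 < M -> (0 < n)%N ->
  (forall z, (forall i, `|z ord0 i - x ord0 i| <= r) ->
    [/\ {for z, continuous f}, has_laplacian f z (lam * f z)
      & `|f z - f x| <= M]) ->
  forall y, (forall i, `|y ord0 i - x ord0 i| <= r / 2) ->
    `|f y - f x| <= n%:R * ((4 * n%:R + lam + 1) * (M / r) * enorm (y - x)).
Proof.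
move=> r0 r1 lam0 M0 n0 Hf y yx.
have lapB := eigen_laplacian_bound r0 r1 lam0 (ltW M0) n0 Hf.
(* The extra 1 provides the strict bound |lap| < N asked for by the axis estimate. *)
pose N := (8 * n%:R + 3 * lam + 1) * (M / r ^+ 2).
pose p (j : nat) : 'rV[R]_n := \row_i (if (i < j)%N then y ord0 i else x ord0 i).
have Mr : 0 < M / r by rewrite divr_gt0.
have r2 : 0 < r / 2 by rewrite divr_gt0.
have step (j : 'I_n) : `|f (p j.+1) - f (p j)| <=
    (4 * n%:R + lam + 1) * (M / r) * enorm (y - x).
  pose t := (y ord0 j - x ord0 j) / 2; pose m := p j + t *: basis_vec R j.
  have tE : `|t| = `|y ord0 j - x ord0 j| / 2.
    by rewrite normrM [`|2^-1|]ger0_norm ?invr_ge0.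
  have pjj : p j ord0 j = x ord0 j by rewrite mxE ltnn.
  have -> : p j.+1 = m + t *: basis_vec R j.
    apply/rowP => i; rewrite !coord_shift; have [->|ij] := eqVneq i j.
      by rewrite pjj mxE ltnSn mulr1n /t; field.
    have ij' : (i == j :> nat) = false by exact: negbTE.
    by rewrite !mulr0n !addr0 !mxE ltnS leq_eqVlt ij'.
  have -> : p j = m - t *: basis_vec R j by rewrite /m addrK.
  (* The midpoint m is within r/2 of x in every coordinate, so a cube of half-side r/2 about m stays
     in the cube where f is controlled. *)
  have cube z : (forall i, `|z ord0 i - m ord0 i| <= r / 2) ->
      forall i, `|z ord0 i - x ord0 i| <= r.
    move=> zm i; have mx : `|m ord0 i - x ord0 i| <= r / 2.
      rewrite coord_shift; have [->|ij] := eqVneq i j.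
        rewrite pjj mulr1n addrAC subrr add0r tE.
        by have := yx j; have := normr_ge0 (y ord0 j - x ord0 j); lra.
      by rewrite mulr0n addr0 mxE; case: ifP; rewrite // subrr normr0 ltW.
    rewrite -(subrK (m ord0 i) (z ord0 i)) -addrA (le_trans (ler_normD _ _))//.
    by have := zm i; lra.
  have td : `|t| <= r / 2.
    by rewrite tE; have := yx j; have := normr_ge0 (y ord0 j - x ord0 j); lra.
  have := @axis_estimate_norm f (fun w => lam * f w) m j (r / 2) M N (f x)
    r2 (ltW M0) _ t td.
  move=> H; apply: le_trans (H _) _.
    move=> z /cube zx; have [cf fl fM] := Hf z zx; split=> //.
    apply: le_lt_trans (lapB z zx) _; rewrite /N ltr_pM2r ?divr_gt0 ?exprn_gt0//.
    by rewrite ltrDl.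
  have -> : 2 * `|t| * ((n%:R * M / (r / 2) ^+ 2 + N / 2) * (r / 2)) =
      (2 * n%:R + (8 * n%:R + 3 * lam + 1) / 4) * (M / r) * `|y ord0 j - x ord0 j|.
    by rewrite tE /N; field; rewrite gt_eqF.
  apply: ler_pM => //.
  - by rewrite mulr_ge0 ?(ltW Mr)// addr_ge0// ?mulr_ge0// ?divr_ge0// !addr_ge0// mulr_ge0.
  - by rewrite ler_wpM2r ?(ltW Mr)//; lra.
  - by have := coord_le_enorm (y - x) j; rewrite !mxE.
have pn : p n = y by apply/rowP => i; rewrite mxE ltn_ord.
have p0 : p 0 = x by apply/rowP => i; rewrite mxE ltn0.
suff H j : (j <= n)%N -> `|f (p j) - f x| <=
    j%:R * ((4 * n%:R + lam + 1) * (M / r) * enorm (y - x)).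
  by rewrite -[in leLHS]pn H.
elim: j => [|j ih] jn; first by rewrite p0 subrr normr0 mul0r.
rewrite -(subrK (f (p j)) (f (p j.+1))) -addrA (le_trans (ler_normD _ _))//.
by rewrite -[j.+1]add1n natrD mulrDl mul1r lerD ?ih ?(ltnW jn)// (step (Ordinal jn)).
Qed.

End InteriorEstimates.

(** * The quasihyperbolic metric *)

Section QuasihyperbolicMetric.
Context {R : realType} {n : nat}.
Implicit Types (D : set 'rV[R]_n) (x y : 'rV[R]_n).

Lemma qh_integral_ge0 D (g : R -> 'rV[R]_n) a b : proper_subdomain D ->
  (0 <= qh_integral D g a b)%E.
Proof.
move=> pD; apply: integral_ge0 => s _.
by rewrite lee_fin invr_ge0 bdist_ge0.
Qed.

Lemma qh_dist_ge0 D x y : proper_subdomain D -> (0 <= qh_dist D x y)%E.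
Proof.
move=> pD; apply: le_ereal_inf_tmp => _ [a [b [g [_ ->]]]].
exact: qh_integral_ge0.
Qed.

Lemma qh_joined_le D x y (K K' : R) :
  K <= K' -> qh_joined D x y K -> qh_joined D x y K'.
Proof.
move=> KK' [L [g [L0 gl gi Dg g0 gL gs cost]]]; exists L, g; split => //.
by apply: le_trans cost _; rewrite lee_fin.
Qed.

(** On the segment from y to z the distance to the boundary is still at least [bdist D y] / 2,
    whence the factor 2. *)
Lemma qh_joined_half_ball D x y z K : proper_subdomain D -> D y ->
  enorm (y - z) <= bdist D y / 2 -> qh_joined D x y K ->
  qh_joined D x z (K + 2 * enorm (y - z) / bdist D y).
Proof.
move=> pD Dy yz J; have d0 := bdist_gt0 pD Dy; have [[_ oD _] _] := pD.
have -> : 2 * enorm (y - z) / bdist D y = enorm (z - y) / (bdist D y / 2).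
  by rewrite enormB; field; rewrite gt_eqF.
apply: qh_joined_segment J => //; first by rewrite divr_gt0.
move=> r /andP[r0 r1].
have yw : enorm (y - (y + r *: (z - y))) <= bdist D y / 2.
  rewrite opprD addrA subrr add0r enormN enormZ ger0_norm// enormB.
  by rewrite (le_trans _ yz)// ler_piMl// enorm_ge0.
split; first by apply: (lt_bdist oD Dy); lra.
by have := bdist_lipschitz y (y + r *: (z - y)) pD; lra.
Qed.

Lemma qh_dist_half_ball D x y : proper_subdomain D -> D x ->
  enorm (x - y) <= bdist D x / 2 -> (qh_dist D x y <= 1%:E)%E.
Proof.
move=> pD Dx xy; apply: qh_joined_dist.
have := qh_joined_half_ball pD Dx xy (qh_joined_refl Dx); apply: qh_joined_le.
have d0 := bdist_gt0 pD Dx.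
by rewrite add0r ler_pdivrMr// mul1r; lra.
Qed.

(* Along an arc, bdist D x + |x - p| grows at most exponentially in the
   quasihyperbolic length. *)
Lemma enorm_le_qh_dist D x y (K : R) : proper_subdomain D -> D x ->
  (qh_dist D x y < K%:E)%E -> enorm (x - y) <= bdist D x * expR (2 * K).
Proof.
move=> pD Dx /ereal_inf_lt[_ [a [b [g [arc ->]]]] IK].
have Ioo : (qh_integral D g a b < +oo)%E by apply: lt_trans IK _; exact: ltry.
have d0 := bdist_gt0 pD Dx.
have := arc_chain (S := fun p k => bdist D x + enorm (x - p) <=
  bdist D x * expR (2 * k)) pD arc Ioo ltr01 (lexx 1).
set v := fine _ => h.
have vK : v <= K.
  rewrite -lee_fin /v fineK ?(ltW IK)//.
  by rewrite ge0_fin_numE// qh_integral_ge0.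
have {h} : bdist D x + enorm (x - y) <= bdist D x * expR (2 * v).
  apply: h; first by rewrite subrr enorm0 addr0 mulr0 expR0 mulr1.
  move=> p q k k' Dp Dq Sp _ pq.
  have dp0 := bdist_gt0 pD Dp.
  have k'k : 0 <= k' - k.
    by rewrite -(pmulr_rge0 (x := 2 * bdist D p)) ?mulr_gt0//;
      exact: le_trans (enorm_ge0 _) pq.
  set A := bdist D x + enorm (x - p) in Sp.
  have dpA : bdist D p <= A by rewrite /A -enormB [leRHS]addrC addrC;
    have := bdist_lipschitz p x pD; lra.
  have h1 : 2 * bdist D p * (k' - k) <= 2 * A * (k' - k).
    by rewrite ler_wpM2r// ler_wpM2l.
  have h2 := enorm_distD p x q.
  (* Since d(p) <= A, a step multiplies A by at most 1 + 2(k' - k), which is at most exp(2(k' -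
     k)). *)
  apply: (@le_trans _ _ (A * (1 + 2 * (k' - k)))).
    have -> : A * (1 + 2 * (k' - k)) = A + 2 * A * (k' - k) by ring.
    by apply: le_trans (lerD (lexx A) h1); rewrite /A; lra.
  have -> : 2 * k' = 2 * k + 2 * (k' - k) by ring.
  rewrite expRD mulrA; apply: ler_pM => //.
  - by rewrite addr_ge0 ?enorm_ge0 ?bdist_ge0.
  - by rewrite addr_ge0// mulr_ge0.
  - exact: expR_ge1Dx.
have : bdist D x * expR (2 * v) <= bdist D x * expR (2 * K).
  by rewrite ler_wpM2l ?(ltW d0)// ler_expR ler_wpM2l.
lra.
Qed.

End QuasihyperbolicMetric.

(** * The unit ball as a proper subdomain *)

Section UnitBall.
Context {R : realType} {n : nat}.
Context (n_gt0 : (0 < n)%N).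
Local Notation B := (@unit_ball R n).

Lemma enorm_basis_vec (i : 'I_n) : enorm (basis_vec R i) = 1.
Proof.
rewrite /enorm (bigD1 i)//= big1 => [|j ji]; rewrite !mxE !eqxx/=.
  by rewrite expr1n addr0 sqrtr1.
by rewrite (negbTE ji) expr0n.
Qed.

Lemma unit_ball_proper : proper_subdomain B.
Proof.
have i0 : 'I_n := Ordinal n_gt0.
have B0 : B 0 by rewrite /unit_ball/= enorm0.
split; last first.
  move=> BT; have : B (basis_vec R i0) by rewrite BT.
  by rewrite /unit_ball/= enorm_basis_vec ltxx.
split; first by exists 0.
  rewrite openE => x /= Bx; rewrite /interior.
  have e0 : 0 < 1 - enorm x by rewrite subr_gt0.
  near=> y; have yx : enorm (y - x) < 1 - enorm x by near: y; exact: near_enorm.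
  by have := enormD (y - x) x; rewrite subrK /unit_ball/=; lra.
have -> : B = \bigcup_(x in B) ((fun t : R => t *: x) @` `[0, 1]).
  apply/seteqP; split => [x Bx|_ [x Bx [t /= + <-]]].
    by exists x => //; exists 1; rewrite /= ?in_itv/= ?ler01 ?lexx// scale1r.
  rewrite in_itv/= => /andP[t0 t1]; rewrite /unit_ball/= enormZ ger0_norm//.
  by rewrite (le_lt_trans _ Bx)// ler_piMl// enorm_ge0.
apply: bigcup_connected.
  exists 0 => x _; exists 0; rewrite /= ?in_itv/= ?lexx ?ler01//.
  by rewrite scale0r.
move=> x _; apply: connected_continuous_connected; first exact: segment_connected.
apply: continuous_subspaceT.
apply: (@lipschitz_enorm_continuous _ _ _ (enorm x)) => s t.
by rewrite -scalerBl enormZ mulrC.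
Unshelve. all: by end_near. Qed.

Lemma bdist_unit_ball_le2 x : B x -> bdist B x <= 2.
Proof.
move=> Bx; pose e := basis_vec R (Ordinal n_gt0).
have [[_ oB _] _] := unit_ball_proper.
have nBe : ~ B e by rewrite /unit_ball/= enorm_basis_vec ltxx.
have := bdist_le_outside oB Bx nBe; have := enormD x (- e).
rewrite enormN enorm_basis_vec; move: Bx; rewrite /unit_ball/=; lra.
Qed.

End UnitBall.

(** * The two implications *)

Section WeakUniformBoundedness.
Context {R : realType} {n : nat}.
Context (n_gt0 : (0 < n)%N).
Local Notation B := (@unit_ball R n).
Context (u : 'rV[R]_n -> 'rV[R]_n) (lambda : 'I_n -> R).
Local Notation Om := (u @` B).
Context (himage : proper_subdomain Om).
Context (hlambda : forall k, 0 <= lambda k).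
Context (hC2 : forall k, C2_on B (coord_fun u k)).
Context (hlap : forall k x, B x ->
  laplacian (coord_fun u k) x = lambda k * coord_fun u k x).

Lemma wub_quasi_lipschitz : weakly_uniformly_bounded B u ->
  exists K c : R, [/\ 0 < K, 0 < c & forall x y, B x -> B y ->
    enorm (x - y) <= c * bdist B x ->
    enorm (u x - u y) <= K * (bdist Om (u x) / bdist B x) * enorm (x - y)].
Proof.
move=> [C C0 wub].
have pB := unit_ball_proper n_gt0 : proper_subdomain B.
have [[_ oB _] _] := pB.
have n1 : 1 <= n%:R :> R by rewrite ler1n.
have n0 : 0 < n%:R :> R by rewrite ltr0n.
pose Lam := \sum_k lambda k.
have Lam0 : 0 <= Lam by apply: sumr_ge0.
have lamLam k : lambda k <= Lam.
  by rewrite /Lam (bigD1 k)//= lerDl sumr_ge0.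
pose K0 := 4 * n%:R + Lam + 1.
have K00 : 0 < K0 by rewrite /K0; lra.
(* In K, one factor n comes from changing coordinates one by one, one from passing from coordinates
   to the Euclidean norm, and 3n from 1/r = 3n/d. The second constant makes |x - y| <= r/2. *)
exists (3 * n%:R ^+ 3 * K0 * C), (6 * n%:R)^-1.
split; [by rewrite !mulr_gt0// exprn_gt0|by rewrite invr_gt0 mulr_gt0|].
move=> x y Bx By xy.
have d0 := bdist_gt0 pB Bx; have d2 := bdist_unit_ball_le2 n_gt0 Bx.
have Oux : Om (u x) by exists x.
have dO0 := bdist_gt0 himage Oux.
set d := bdist B x in d0 d2 xy *; set dO := bdist Om (u x) in dO0 *.
(* The cube of half-side r lies in the Euclidean ball of radius d/3. There d_B >= 2d/3, so r_B(x, z)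
   <= (d/3)/(2d/3) = 1/2 and the hypothesis on u applies; r <= 1 follows from d <= 2. *)
pose r := d / (3 * n%:R); have n3 : 0 < 3 * n%:R :> R by lra.
have r0 : 0 < r by rewrite divr_gt0.
have rn : n%:R * r = d / 3 by rewrite /r; field; rewrite gt_eqF.
have r1 : r <= 1 by rewrite ler_pdivrMr//; lra.
have M0 : 0 < C * dO by rewrite mulr_gt0.
have cube (z : 'rV[R]_n) : (forall i, `|z ord0 i - x ord0 i| <= r) ->
    B z /\ enorm (u z - u x) <= C * dO.
  move=> zx; have xz : enorm (x - z) <= d / 3.
    rewrite enormB -rn; apply: enorm_le_coord => i.
    by have := zx i; rewrite !mxE.
  have Bz : B z by apply: (lt_bdist oB Bx); rewrite -/d; lra.
  split => //.
  have dz : 2 * d / 3 <= bdist B z.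
    by have := bdist_lipschitz x z pB; rewrite -/d; lra.
  have Ouz : Om (u z) by exists z.
  have dOz := bdist_gt0 himage Ouz.
  have rd : rdist B x z <= 1 / 2.
    have m0 : 0 < Num.min d (bdist B z) by rewrite lt_min d0/=; lra.
    rewrite /rdist -/d ler_pdivrMr//.
    have : 2 * d / 3 <= Num.min d (bdist B z) by rewrite le_min dz andbT; lra.
    lra.
  have := wub x z Bx Bz rd; rewrite /rdist -/dO.
  have m0 : 0 < Num.min dO (bdist Om (u z)) by rewrite lt_min dO0.
  rewrite ler_pdivrMr// enormB => /le_trans; apply.
  by rewrite ler_wpM2l ?(ltW C0)// ge_min lexx.
have yx i : `|y ord0 i - x ord0 i| <= r / 2.
  have := coord_le_enorm (x - y) i; rewrite !mxE distrC => /le_trans; apply.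
  apply: (le_trans xy); rewrite /r le_eqVlt; apply/orP; left; apply/eqP.
  by field; rewrite gt_eqF.
have coordb k : `|(u x - u y) ord0 k| <=
    n%:R * (K0 * (C * dO / r) * enorm (x - y)).
  have := @eigen_lipschitz R n (coord_fun u k) x r (C * dO) (lambda k)
    r0 r1 (hlambda k) M0 n_gt0 _ y yx.
  rewrite !mxE distrC (enormB x y) => H; apply: le_trans (H _) _.
    move=> z /cube[Bz uz]; split.
    - by have [] := hC2 k Bz.
    - by rewrite -hlap//; apply: C2_has_laplacian (hC2 k).
    - by apply: le_trans uz; have := coord_le_enorm (u z - u x) k; rewrite !mxE.
  have Mr0 : 0 <= C * dO / r by rewrite divr_ge0// ltW.
  apply: ler_wpM2l; first exact: ltW.
  apply: ler_wpM2r; first exact: enorm_ge0.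
  by apply: ler_wpM2r => //; rewrite /K0; have := lamLam k; lra.
apply: (le_trans (enorm_le_coord coordb)).
rewrite le_eqVlt; apply/orP; left; apply/eqP.
by rewrite /r; field; rewrite !gt_eqF.
Qed.

Lemma wub_qh_lipschitz : weakly_uniformly_bounded B u ->
  exists C : R, forall x y, B x -> B y ->
    (qh_dist Om (u x) (u y) <= C%:E * qh_dist B x y)%E.
Proof.
move=> /wub_quasi_lipschitz[K [c [K0 c0 uK]]].
have pB := unit_ball_proper n_gt0 : proper_subdomain B.
(* A step from p to q costs at most 2 |u p - u q| / d(u p) <= 2K |p - q| / d(p) in the image, and |p
   - q| <= 2 d(p) (k' - k). *)
exists (4 * K) => x y Bx By.
have K4 : 0 < 4 * K by rewrite mulr_gt0.
rewrite -lee_pdivrMl//; apply: le_ereal_inf_tmp => _ [a [b [g [arc ->]]]].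
rewrite lee_pdivrMl//.
have [Ioo|] := ltP (qh_integral B g a b) +oo%E; last first.
  by rewrite leye_eq => /eqP ->; rewrite gt0_muley ?lte_fin// leey.
(* Steps must be short enough for the Lipschitz estimate (c), for [arc_chain] (1), and for u q to
   lie within half of d(u p) from u p (1/(2K)). *)
pose c1 := Num.min (Num.min c 1) (2 * K)^-1.
have c10 : 0 < c1 by rewrite !lt_min c0 ltr01/= invr_gt0 mulr_gt0.
have [c11 [c1c c1K]] : c1 <= 1 /\ (c1 <= c /\ c1 <= (2 * K)^-1).
  by rewrite /c1 !ge_min !lexx !orbT.
have := arc_chain (S := fun p k => qh_joined Om (u x) (u p) (4 * K * k))
  pB arc Ioo c10 c11.
set v := fine _ => h.
have -> : qh_integral B g a b = v%:E.
  by rewrite /v fineK// ge0_fin_numE// qh_integral_ge0.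
rewrite -EFinM; apply: qh_joined_dist; apply: h.
  by rewrite mulr0; apply: qh_joined_refl; exists x.
move=> p q k k' Bp Bq J pq1 pq2.
have dp := bdist_gt0 pB Bp.
have Op : Om (u p) by exists p.
have dO := bdist_gt0 himage Op.
have upq : enorm (u p - u q) <= K * (bdist Om (u p) / bdist B p) * enorm (p - q).
  by apply: uK => //; apply: le_trans pq1 _; rewrite ler_wpM2r// ltW.
have Kd : 0 <= K * (bdist Om (u p) / bdist B p).
  by rewrite mulr_ge0 ?divr_ge0// ltW.
have half : enorm (u p - u q) <= bdist Om (u p) / 2.
  apply: le_trans upq _.
  apply: (@le_trans _ _ (K * (bdist Om (u p) / bdist B p) *
      ((2 * K)^-1 * bdist B p))).
    rewrite ler_wpM2l//; apply: le_trans pq1 _.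
    by rewrite ler_wpM2r// ltW.
  by rewrite le_eqVlt; apply/orP; left; apply/eqP; field; rewrite !gt_eqF.
apply: qh_joined_le (qh_joined_half_ball himage Op half J).
suff : 2 * enorm (u p - u q) / bdist Om (u p) <= 4 * K * (k' - k) by lra.
rewrite ler_pdivrMr//.
have h1 := ler_wpM2l Kd pq2.
have e : K * (bdist Om (u p) / bdist B p) * (2 * bdist B p * (k' - k)) =
    2 * K * (k' - k) * bdist Om (u p) by field; rewrite gt_eqF.
lra.
Qed.

Lemma qh_lipschitz_wub (C : R) :
  (forall x y, B x -> B y ->
    (qh_dist Om (u x) (u y) <= C%:E * qh_dist B x y)%E) ->
  weakly_uniformly_bounded B u.
Proof.
move=> uC; have pB := unit_ball_proper n_gt0 : proper_subdomain B.
(* C may be negative, hence |C|; the added 1 gives the strict inequality k(u x, u y) < |C| + 1 from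
   which an arc of cost below it is extracted. *)
pose E := expR (2 * (`|C| + 1)).
have bound x y : B x -> B y -> enorm (x - y) <= bdist B x / 2 ->
    enorm (u x - u y) <= bdist Om (u x) * E.
  move=> Bx By xy; apply: enorm_le_qh_dist => //.
  apply: le_lt_trans (uC x y Bx By) _.
  apply: (@le_lt_trans _ _ (`|C|%:E * 1%:E)%E).
    apply: (@le_trans _ _ (`|C|%:E * qh_dist B x y)%E).
      by apply: lee_wpmul2r; [exact: qh_dist_ge0|rewrite lee_fin ler_norm].
    by apply: lee_wpmul2l; [rewrite lee_fin|exact: qh_dist_half_ball].
  by rewrite -EFinM lte_fin mulr1 ltrDl.
exists E; first exact: expR_gt0.
move=> x y Bx By; rewrite /rdist.
have dx := bdist_gt0 pB Bx; have dy := bdist_gt0 pB By.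
have ox : 0 < bdist Om (u x) by apply: bdist_gt0 => //; exists x.
have oy : 0 < bdist Om (u y) by apply: bdist_gt0 => //; exists y.
rewrite !ler_pdivrMr ?lt_min ?dx ?ox// => xy.
have [xyx xyy] : enorm (x - y) <= bdist B x / 2 /\ enorm (x - y) <= bdist B y / 2.
  have : Num.min (bdist B x) (bdist B y) <= bdist B x by rewrite ge_min lexx.
  have : Num.min (bdist B x) (bdist B y) <= bdist B y by rewrite ge_min lexx orbT.
  by split; lra.
rewrite -ler_pdivrMl ?expR_gt0// le_min !ler_pdivrMl ?expR_gt0//.
rewrite ![E * _]mulrC bound//= enormB bound// enormB//.
Qed.

End WeakUniformBoundedness.

Theorem theorem2 (R : realType) (n : nat) (hn : (2 <= n)%N)
    (u : 'rV[R]_n -> 'rV[R]_n) (lambda : 'I_n -> R)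
    (himage : proper_subdomain (u @` @unit_ball R n))
    (hlambda : forall k, 0 <= lambda k)
    (hC2 : forall k, C2_on (@unit_ball R n) (coord_fun u k))
    (hlap : forall k x, @unit_ball R n x ->
       laplacian (coord_fun u k) x = lambda k * coord_fun u k x) :
  weakly_uniformly_bounded (@unit_ball R n) u <->
  exists C : R, forall x y, @unit_ball R n x -> @unit_ball R n y ->
    (qh_dist (u @` @unit_ball R n) (u x) (u y) <=
     C%:E * qh_dist (@unit_ball R n) x y)%E.
Proof.
have n_gt0 : (0 < n)%N by exact: ltnW.
split; first exact: wub_qh_lipschitz hlap.
by move=> [C]; exact: qh_lipschitz_wub.
Qed.
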